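(* Let $k\ge1$ and $\mathcal{A}=\mathrm{NH}_{k,\hbar=0}$. A full set of non-gauge-equivalent $\mathbb{Z}^2$-graded deformations of $\mathcal{A}$ over $\mathbb{C}[[\hbar]]_{(0,1)}$ is given by the elements $\nu_A$, $A\in\mathbb{C}$. That is, every $\nu\in\mathrm{MC}(\mathrm{HC}(\mathcal{A}),\mathbb{C}[[\hbar]]_{(0,1)})_0$ is $\mathbb{Z}^2$-graded gauge equivalent to $\nu_A$ for some scalar $A\in\mathbb{C}$, and for $A\ne A'$ the deformations $\nu_A$ and $\nu_{A'}$ are not $\mathbb{Z}^2$-graded gauge equivalent.
   Context: $\mathcal{A}=\mathrm{NH}_{k,\hbar=0}$ is the quotient of the free algebra $\mathbb{C}\langle X_1,\dots,X_k,\sigma_1,\dots,\sigma_{k-1}\rangle$ by the relations $s=\varphi_s$ of the following reduction system $R=\{(s,\varphi_s)\}_{s\in S}$ (all indices within range), written as replacement rules $s\mapsto\varphi_s$: $\sigma_iX_i\mapsto X_{i+1}\sigma_i$; $\sigma_iX_{i+1}\mapsto X_i\sigma_i$; $\sigma_iX_j\mapsto X_j\sigma_i$ for $j\ne i,i+1$; $\sigma_i^2\mapsto 0$; $\sigma_i\sigma_{i+1}\sigma_i\mapsto\sigma_{i+1}\sigma_i\sigma_{i+1}$; $\sigma_i\sigma_j\mapsto\sigma_j\sigma_i$ for $j\le i-2$; $X_iX_j\mapsto X_jX_i$ for $j<i$. A word is irreducible if it contains no $s\in S$ as a subword, and $\mathbb{C}\mathrm{Irr}_S$ is the span of the irreducible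 words. $R$ is taken as a reduction-unique reduction system, so that the projection from the free algebra restricts to a linear isomorphism $\mathbb{C}\mathrm{Irr}_S\cong\mathcal{A}$. The algebra $\mathcal{A}$ is $\mathbb{Z}^2$-graded by $\deg X_i=(-1,0)$, $\deg\sigma_i=(1,1)$ and is concentrated in cohomological degree $0$; its product is denoted $\mu$. $\mathbb{C}[[\hbar]]_{(0,1)}$ denotes the deformation base $\mathbb{C}[[\hbar]]$ with $\mathbb{Z}^2$-grading induced by $\deg\hbar=(0,1)$. $\mathrm{HC}(\mathcal{A})$ is the Hochschild DGLA of $\mathcal{A}$, with the $\mathbb{Z}^2$-grading inherited from $\mathcal{A}$. An element of $\mathrm{MC}(\mathrm{HC}(\mathcal{A}),\mathbb{C}[[\hbar]]_{(0,1)})_0$ is a Maurer-Cartan element over $\mathbb{C}[[\hbar]]$ that is homogeneous of $\mathbb{Z}^2$-degree $0$; this is the same as a $\mathbb{Z}^2$-graded deformation of $\mathcal{A}$. Concretely, it is a bilinear map $\nu:\mathcal{A}\times\mathcal{A}\to\hbar\mathcal{A}[[\hbar]]$, extended $\mathbb{C}[[\hbar]]$-bilinearly, such that $\mu+\nu$ is associative on $\mathcal{A}[[\hbar]]$ and, for homogeneous $a,b$, the $\hbar^n$-coefficient of $\nu(a,b)$ lies in degree $\deg a+\deg b-(0,n)$. Two such elements $\nu,\nu'$ are $\mathbb{Z}^2$-graded gauge equivalent if they are related by the gauge action of an element of $\hbar\,\mathrm{HC}^0(\mathcal{A})[[\hbar]]$ that is homogeneous of $\mathbb{Z}^2$-degree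 $0$; equivalently, if there is a $\mathbb{C}[[\hbar]]$-linear, $\mathbb{Z}^2$-homogeneous (degree $0$) algebra isomorphism $(\mathcal{A}[[\hbar]],\mu+\nu)\to(\mathcal{A}[[\hbar]],\mu+\nu')$ equal to the identity modulo $\hbar$. For a scalar $A$, $\nu_A\in\mathrm{MC}(\mathrm{HC}(\mathcal{A}),\mathbb{C}[[\hbar]]_{(0,1)})_0$ is defined as the deformation arising from the deformed reduction system $\{(s,\varphi_s+g_s)\}_{s\in S}$ with $\varphi_s+g_s=X_{i+1}\sigma_i+A\hbar$ for $s=\sigma_iX_i$, $i\in\{1,\dots,k-1\}$, and $\varphi_s+g_s=\varphi_s$ for every $s\in S$ not of the form $\sigma_iX_i$. Here the deformation arising from a deformed reduction system is the one whose deformed product $\mu+\nu_A$, on $\mathbb{C}[[\hbar]]\,\widehat\otimes\,\mathbb{C}\mathrm{Irr}_S\cong\mathcal{A}[[\hbar]]$, is given by concatenation of words and subsequent reduction to irreducible words by the replacement rules $s\mapsto\varphi_s+g_s$.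
   Formalization: ν_A is defined with the extra value −Aħ on s=σ_iX_{i+1} (with 0 there, σ_iσ_iX_i gives Aħσ_i=0, so no ν_A exists for A≠0, k≥2); non-equivalence for A≠A' is stated for k≥2 only (at k=1 all ν_A coincide); reduction-uniqueness, false for k≥4, is not assumed. *)

(* Defs.v *)
From HB Require Import structures.
From mathcomp Require Import all_boot all_order all_algebra finmap generic_quotient ring_quotient.
From mathcomp Require Import complex boolp reals.
From mathcomp Require Import monalg.

Set Implicit Arguments.
Unset Strict Implicit.
Unset Printing Implicit Defensive.

Import Order.TTheory GRing.Theory Num.Theory.
Local Open Scope ring_scope.
Local Open Scope quotient_scope.

(* Indices are 0-based: [X_ i] is X_{i+1} and [sig_ i] is sigma_{i+1}, so that
   [sig_ i] exchanges the variables of indices [i] and [i.+1]. *)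
Definition letter (k : nat) : choiceType := ('I_k + 'I_k.-1)%type.
Definition X_ (k : nat) (i : 'I_k) : letter k := inl i.
Definition sig_ (k : nat) (i : 'I_k.-1) : letter k := inr i.

Notation word k := (seq (letter k)).
Notation free K k := {malg K[{fmonom (letter k)}]}.

Definition mono (K : comNzRingType) (k : nat) (w : word k) : free K k :=
  << FMonom w >>.

(* The replacement rules [s |-> phi_s + g_s], where [g_s] is the constant [c]
   for s = sigma_i X_i, the constant [- c] for s = sigma_i X_{i+1}, and 0
   otherwise; [c = 0] gives the undeformed system.  The value [- c] is forced by
   the value [c]: resolving the overlap sigma_i sigma_i X_i gives
     0 = (sigma_i sigma_i) X_i = sigma_i (X_{i+1} sigma_i + c)
       = (sigma_i X_{i+1}) sigma_i + c sigma_i. *)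
Inductive rule (K : comNzRingType) (k : nat) (c : K) :
    word k -> free K k -> Prop :=
| RuleSXl (i : 'I_k.-1) (a b : 'I_k) : a = i :> nat -> b = i.+1 :> nat ->
    rule c [:: sig_ i; X_ a] (mono K [:: X_ b; sig_ i] + c%:MP)
| RuleSXr (i : 'I_k.-1) (a b : 'I_k) : a = i :> nat -> b = i.+1 :> nat ->
    rule c [:: sig_ i; X_ b] (mono K [:: X_ a; sig_ i] - c%:MP)
| RuleSXfar (i : 'I_k.-1) (j : 'I_k) : j <> i :> nat -> j <> i.+1 :> nat ->
    rule c [:: sig_ i; X_ j] (mono K [:: X_ j; sig_ i])
| RuleSS (i : 'I_k.-1) :
    rule c [:: sig_ i; sig_ i] 0
| RuleBraid (i j : 'I_k.-1) : j = i.+1 :> nat ->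
    rule c [:: sig_ i; sig_ j; sig_ i] (mono K [:: sig_ j; sig_ i; sig_ j])
| RuleSSfar (i j : 'I_k.-1) : (j + 2 <= i)%N ->
    rule c [:: sig_ i; sig_ j] (mono K [:: sig_ j; sig_ i])
| RuleXX (i j : 'I_k) : (j < i)%N ->
    rule c [:: X_ i; X_ j] (mono K [:: X_ j; X_ i]).

Section QuotientAlgebra.
Variables (F : fieldType) (k : nat).

(* The two-sided ideal generated by the elements [s - phi_s]. *)
Inductive in_relations : free F k -> Prop :=
| RelGen (s : word k) (phi a b : free F k) :
    rule 0 s phi -> in_relations (a * (mono F s - phi) * b)
| Rel0 : in_relations 0
| RelD (p q : free F k) :
    in_relations p -> in_relations q -> in_relations (p + q).

Lemma in_relationsMl a p : in_relations p -> in_relations (a * p).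
Proof.
elim=> [s phi b d r||x y _ hx _ hy].
- by rewrite !mulrA; exact: RelGen.
- by rewrite mulr0; exact: Rel0.
- by rewrite mulrDr; exact: RelD.
Qed.

Lemma in_relationsMr a p : in_relations p -> in_relations (p * a).
Proof.
elim=> [s phi b d r||x y _ hx _ hy].
- by rewrite -mulrA; exact: RelGen.
- by rewrite mul0r; exact: Rel0.
- by rewrite mulrDl; exact: RelD.
Qed.

Lemma in_relations_coef1 p : in_relations p -> p@_(@mone _) = 0.
Proof.
have m0 (w : word k) : w != [::] -> (mono F w)@_(@mone _) = 0.
  move=> w0; rewrite mcoeffU1; case: eqP => // /(congr1 (@fmonom_val _)) /=.
  by rewrite fm1 => /eqP; rewrite (negPf w0).
elim=> [s phi a b r||x y _ hx _ hy].
- have [hs hphi] : (mono F s)@_(@mone _) = 0 /\ phi@_(@mone _) = 0.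
    case: r => [i u v _ _|i u v _ _|i j _ _|i|i j _|i j _|i j _];
      split; try exact: m0.
    + by rewrite malgC0E addr0 m0.
    + by rewrite malgC0E subr0 m0.
    + exact: mcoeff0.
  by rewrite !rmorphM rmorphB /= hs hphi subr0 mulr0 mul0r.
- exact: mcoeff0.
- by rewrite mcoeffD hx hy addr0.
Qed.

Definition relations (p : free F k) : bool := `[< in_relations p >].

Lemma relations_zmod_closed : zmod_closed relations.
Proof.
split=> [|p q]; first by apply/asboolP; exact: Rel0.
move=> /asboolP hp /asboolP hq; apply/asboolP; apply: RelD hp _.
by rewrite -mulN1r; exact: in_relationsMl.
Qed.

HB.instance Definition _ :=
  GRing.isZmodClosed.Build (free F k) relations relations_zmod_closed.

Definition relations_ideal : zmodClosed (free F k) :=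
  GRing.ZmodClosed.clone (free F k) relations _.

(* The algebra NH_{k, hbar = 0}. *)
Definition NH : Type :=
  {ideal_quot relations_ideal}.

HB.instance Definition _ := GRing.Zmodule.on NH.
HB.instance Definition _ := EqQuotient.on NH.

Lemma NH_eqP (p q : free F k) :
  reflect (in_relations (p - q)) (\pi_NH p == \pi_NH q).
Proof. by rewrite -(@Quotient.idealrBE _ relations_ideal); exact: asboolP. Qed.

Lemma pi_NHD (p q : free F k) : \pi_NH (p + q) = \pi_NH p + \pi_NH q.
Proof. exact: (@Quotient.pi_add _ relations_ideal). Qed.

Lemma pi_NH0 : \pi_NH 0 = 0.
Proof. by apply: (addrI (\pi_NH 0)); rewrite -pi_NHD !addr0. Qed.

Definition NH_one : NH := \pi_NH 1.
Definition NH_mul (x y : NH) : NH := \pi_NH (repr x * repr y).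
Definition NH_scale (c : F) (x : NH) : NH := \pi_NH (c *: repr x).

Lemma in_relations_repr (p : free F k) : in_relations (p - repr (\pi_NH p)).
Proof. by apply/NH_eqP; rewrite reprK. Qed.

Lemma pi_NHM (p q : free F k) : \pi_NH (p * q) = NH_mul (\pi_NH p) (\pi_NH q).
Proof.
apply/eqP/NH_eqP.
set p' := repr (\pi_NH p); set q' := repr (\pi_NH q).
have -> : p * q - p' * q' = (p - p') * q + p' * (q - q').
  by rewrite mulrBl mulrBr addrA subrK.
apply: RelD; first exact: in_relationsMr (in_relations_repr p).
exact: in_relationsMl (in_relations_repr q).
Qed.

Lemma pi_NHZ c (p : free F k) : \pi_NH (c *: p) = NH_scale c (\pi_NH p).
Proof.
apply/eqP/NH_eqP; rewrite -scalerBr -mul_malgC.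
exact: in_relationsMl (in_relations_repr p).
Qed.

Lemma NH_surj (x : NH) : exists p : free F k, x = \pi_NH p.
Proof. by exists (repr x); rewrite reprK. Qed.

Lemma NH_mulA : associative NH_mul.
Proof. by move=> x y z; case: (NH_surj x) => ? ->; case: (NH_surj y) => ? ->; case: (NH_surj z) => ? ->; rewrite -!pi_NHM mulrA. Qed.
Lemma NH_mul1 : left_id NH_one NH_mul.
Proof. by move=> x; case: (NH_surj x) => ? ->; rewrite -pi_NHM mul1r. Qed.
Lemma NH_mulr1 : right_id NH_one NH_mul.
Proof. by move=> x; case: (NH_surj x) => ? ->; rewrite -pi_NHM mulr1. Qed.
Lemma NH_mulDl : left_distributive NH_mul +%R.
Proof.
move=> x y z; case: (NH_surj x) => ? ->; case: (NH_surj y) => ? ->; case: (NH_surj z) => ? ->.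
by rewrite -pi_NHD -!pi_NHM -pi_NHD mulrDl.
Qed.
Lemma NH_mulDr : right_distributive NH_mul +%R.
Proof.
move=> x y z; case: (NH_surj x) => ? ->; case: (NH_surj y) => ? ->; case: (NH_surj z) => ? ->.
by rewrite -pi_NHD -!pi_NHM -pi_NHD mulrDr.
Qed.
Lemma NH_one_neq0 : NH_one != 0.
Proof.
rewrite -pi_NH0; apply/negP => /NH_eqP/in_relations_coef1 /eqP.
by rewrite subr0 mcoeff1 eqxx oner_eq0.
Qed.

HB.instance Definition _ := GRing.Zmodule_isNzRing.Build NH
  NH_mulA NH_mul1 NH_mulr1 NH_mulDl NH_mulDr NH_one_neq0.

Lemma NH_scaleA a b x : NH_scale a (NH_scale b x) = NH_scale (a * b) x.
Proof. by case: (NH_surj x) => ? ->; rewrite -!pi_NHZ scalerA. Qed.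
Lemma NH_scale1 : left_id 1 NH_scale.
Proof. by move=> x; case: (NH_surj x) => ? ->; rewrite -pi_NHZ scale1r. Qed.
Lemma NH_scaleDr : right_distributive NH_scale +%R.
Proof.
move=> c x y; case: (NH_surj x) => ? ->; case: (NH_surj y) => ? ->; by rewrite -pi_NHD -!pi_NHZ -pi_NHD scalerDr.
Qed.
Lemma NH_scaleDl x : {morph NH_scale^~ x : a b / a + b}.
Proof. by move=> a b; case: (NH_surj x) => ? ->; rewrite -!pi_NHZ -pi_NHD scalerDl. Qed.

HB.instance Definition _ := GRing.Zmodule_isLmodule.Build F NH
  NH_scaleA NH_scale1 NH_scaleDr NH_scaleDl.

Lemma NH_scaleAl (c : F) (x y : NH) :
  NH_scale c (NH_mul x y) = NH_mul (NH_scale c x) y.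
Proof.
case: (NH_surj x) => p ->; case: (NH_surj y) => q ->.
rewrite -(pi_NHM p q) -(pi_NHZ c p) -(pi_NHZ c (p * q)).
by rewrite -(pi_NHM (c *: p) q) scalerAl.
Qed.

HB.instance Definition _ := GRing.Lmodule_isLalgebra.Build F NH NH_scaleAl.

Lemma NH_scaleAr (c : F) (x y : NH) :
  NH_scale c (NH_mul x y) = NH_mul x (NH_scale c y).
Proof.
case: (NH_surj x) => p ->; case: (NH_surj y) => q ->.
rewrite -(pi_NHM p q) -(pi_NHZ c q) -(pi_NHZ c (p * q)).
rewrite -(pi_NHM p (c *: q)); congr (\pi_NH _).
apply/malgP => w; rewrite mcoeffZ.
rewrite (mcoeffMlw w (fsubset_refl (msupp p)) (fsubset_refl (msupp q))).
rewrite (mcoeffMlw w (fsubset_refl (msupp p)) (msuppZ_le c q)) mulr_sumr.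
apply: eq_bigr => u _; rewrite mulr_sumr; apply: eq_bigr => v _.
by rewrite mcoeffZ mulrnAr mulrCA.
Qed.

HB.instance Definition _ := GRing.Lalgebra_isAlgebra.Build F NH NH_scaleAr.

Definition cls (w : word k) : NH := \pi_NH (mono F w).

Definition letter_deg (l : letter k) : int * int :=
  match l with inl _ => (-1, 0) | inr _ => (1, 1) end.

Definition word_deg (w : word k) : int * int := \sum_(l <- w) letter_deg l.

Definition homog (d : int * int) (a : NH) : Prop :=
  exists2 p : free F k,
    forall w, w \in msupp p -> word_deg w = d & \pi_NH p = a.

End QuotientAlgebra.

(* Formal power series in hbar, as sequences of coefficients. *)
Definition fps (V : Type) := nat -> V.

Section Deformations.
Variables (F : fieldType) (k : nat).
Local Notation A := (NH F k).

Definition fps_scale (c : fps F) (f : fps A) : fps A :=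
  fun n => \sum_(i < n.+1) c i *: f (n - i)%N.

(* Total degree [d], with deg hbar = (0, 1). *)
Definition fps_homog (d : int * int) (f : fps A) : Prop :=
  forall n : nat, homog (d.1, d.2 - n%:Z) (f n).

(* [nu a b n] is the hbar^n-coefficient of nu(a, b). *)
Definition cochain := A -> A -> fps A.

(* mu + nu on A x A. *)
Definition deformed (nu : cochain) (a b : A) : fps A :=
  fun n => (if n == 0%N then a * b else 0) + nu a b n.

(* The C[[hbar]]-bilinear extension of mu + nu to A[[hbar]]. *)
Definition star (nu : cochain) (f g : fps A) : fps A :=
  fun n => \sum_(i < n.+1) \sum_(j < (n - i).+1)
    deformed nu (f i) (g j) (n - i - j)%N.

(* MC(HC(A), C[[hbar]]_(0,1))_0. *)
Record graded_MC (nu : cochain) : Prop := GradedMC {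
  MC_linearl : forall b n, linear (fun a => nu a b n);
  MC_linearr : forall a n, linear (fun b => nu a b n);
  MC_hbar : forall a b, nu a b 0%N = 0;
  MC_assoc : forall f g h, star nu f (star nu g h) = star nu (star nu f g) h;
  MC_homog : forall d e a b, homog d a -> homog e b ->
    fps_homog (d + e) (nu a b)
}.

Definition gauge_equiv (nu nu' : cochain) : Prop :=
  exists T : fps A -> fps A,
    [/\ bijective T,
        forall (c : fps F) (f g : fps A),
          T (fps_scale c f \+ g) = fps_scale c (T f) \+ T g,
        forall f, T f 0%N = f 0%N,
        forall f g, T (star nu f g) = star nu' (T f) (T g)
      & forall d f, fps_homog d f -> fps_homog d (T f)].

(* Irr_S *)
Definition irreducible (w : word k) : Prop :=
  forall (u s v : word k) (phi : free F k), rule 0 s phi -> w <> u ++ s ++ v.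

(* A basic reduction: the word [u s v] is replaced by [u (phi_s + g_s) v] and all
   other words are left unchanged. *)
Inductive reduction (K : comNzRingType) (c : K) : free K k -> free K k -> Prop :=
| Reduction (u s v : word k) (phi p : free K k) : rule c s phi ->
    reduction c p (p + p@_(FMonom (u ++ s ++ v)) *:
                       (mono K u * phi * mono K v - mono K (u ++ s ++ v))).

Inductive reduces (K : comNzRingType) (c : K) (p : free K k) :
    free K k -> Prop :=
| ReducesRefl : reduces c p p
| ReducesStep q r : reduces c p q -> reduction c q r -> reduces c p r.

(* The projection C[hbar]<X, sigma> -> A[[hbar]], where C[hbar] is {poly C}. *)
Definition project (p : free {poly F} k) : fps A :=
  fun n => \sum_(w <- msupp p) (p@_w)`_n *: cls F w.

(* [nu] is nu_a: the product mu + nu of two irreducible words is obtained by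
   concatenating and reducing with g_s = +/- a hbar. *)
Definition arises_from (a : F) (nu : cochain) : Prop :=
  graded_MC nu /\
  forall (u v : word k) (p : free {poly F} k),
    irreducible u -> irreducible v ->
    reduces (a *: 'X) (mono {poly F} (u ++ v)) p ->
    (forall w, w \in msupp p -> irreducible w) ->
    deformed nu (cls F u) (cls F v) = project p.

End Deformations.

Arguments irreducible F {k} w.

(* Main.v *)
From HB Require Import structures.
From mathcomp Require Import all_boot all_order all_algebra perm finmap.
From mathcomp Require Import generic_quotient ring_quotient.
From mathcomp Require Import complex boolp functions reals monalg.
From mathcomp Require Import zify.
(* Last, since the notation [free] of [vector] would hide that of [Defs]. *)
Require Import Defs.

(* By degree reasons a graded deformation of degree 0 keeps all relations of the
   undeformed algebra except sigma_i X_j = X_(s_i j) sigma_i + e_ij hbar, with e_ij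
   scalar; sigma_i^2 = 0 and the braid relations force
   e_ij = a (delta_(j, i) - delta_(j, i+1)) for a single scalar a.

   Irreducible words are not linearly independent (for k >= 4 the irreducible words
   sigma_1 sigma_3 sigma_2 sigma_1 and sigma_3 sigma_2 sigma_1 sigma_2 have the same
   class), so the deformed product is not read off from a basis.  Instead, divided
   differences D_pq of the polynomial part act on the algebra, and the operators
   X_j and sigma_i + a hbar D_(i, i+1) on power series satisfy the deformed
   relations.  In any representation of the deformed relations an element acts
   through its normal form (the X_j on the left, moved there by the undeformed
   relations).  On the representation above this action is the product of nu_a; on
   a deformation nu with constants e_ij as above, acting on 1 gives the gauge
   equivalence between nu_a and nu.  Distinct values of a are not equivalent since
   an equivalence fixes 1, X_j and sigma_i for degree reasons. *)

Set Implicit Arguments.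
Unset Strict Implicit.
Unset Printing Implicit Defensive.

Import Order.TTheory GRing.Theory Num.Theory.
Local Open Scope ring_scope.
Local Open Scope quotient_scope.

(** The correction a hbar D_(i, i+1) is what the deformed relation leaves behind when sigma_i is
    moved across a polynomial in the X_j: one root coefficient per letter, collected by the twisted
    Leibniz rule. The resulting representation is universal: for a vector v in any representation of
    the same relations, f |-> f.v is an intertwiner. Applied to the representation itself this is
    associativity of the product of nu_a; applied to left multiplications by the generators in a
    deformation, with v = 1, it is multiplicativity of the gauge map. For nu_a itself, irreducible
    words being dependent, the outcome of a reduction is controlled by an invariant instead of
    confluence: a word, read letter by letter as an operator, is applied to 1. The deformed rules
    are identities between these operators, and an irreducible word gives back its class. Uniqueness
    of nu_a needs termination, since the defining condition speaks only of reductions that reach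
    irreducible words. Invertibility of 2 removes the constants e_ij with j fixed by s_i, where
    sigma_i^2 = 0 only gives 2 e_ij = 0. *)

Lemma sandwich0 (T : pzRingType) (V : nmodType) (f : T -> V) (gen : T -> Prop) p :
  (forall P : T -> Prop, P 0 -> (forall x, gen x -> P x) ->
     (forall x y, P x -> P y -> P (x + y)) -> forall x, P x) ->
  f 0 = 0 -> (forall x y, f (x + y) = f x + f y) ->
  (forall x y, gen x -> gen y -> f (x * p * y) = 0) ->
  forall x y, f (x * p * y) = 0.
Proof.
move=> ind f0 fD fp x y; move: x.
apply: (ind (fun x => f (x * p * y) = 0)) => [|x gx|x x' IH IH'].
- by rewrite !mul0r.
- move: y; apply: (ind (fun y => f (x * p * y) = 0)) => [|y gy|y y' IH IH'];
    [by rewrite mulr0 | exact: fp |].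
  by rewrite mulrDr fD IH IH' addr0.
- by rewrite !mulrDl fD IH IH' addr0.
Qed.

Fact mulr_sandwichB (T : pzRingType) (a b c d : T) :
  a * (b - c) * d = a * b * d - a * c * d.
Proof. by rewrite mulrBr mulrBl. Qed.

(** * Words in the free algebra and additive extension from words *)

Section FreeAlgebra.
Variables (K : comNzRingType) (k : nat).
Implicit Types (p q : free K k) (u v w : word k).

Lemma monoM u v : mono K u * mono K v = mono K (u ++ v).
Proof. by rewrite /mono malgM_def fgmulUU mulr1 /= [mmul _ _]fmmulE. Qed.

Lemma mono3 u v w : mono K u * mono K v * mono K w = mono K (u ++ v ++ w).
Proof. by rewrite monoM monoM catA. Qed.

Lemma mono_sandwichB u v s t : mono K u * (mono K s - mono K t) * mono K v =
  mono K (u ++ s ++ v) - mono K (u ++ t ++ v).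
Proof. by rewrite -!mono3; exact: mulr_sandwichB. Qed.

Lemma mcoeff_mono u (w : {fmonom (letter k)}) : (mono K u)@_w = (u == w)%:R.
Proof. by rewrite /mono mcoeffU1 fmP. Qed.

Lemma malg_words p : p = \sum_(w <- msupp p) p@_w *: mono K w.
Proof.
rewrite {1}(monalgE p); apply: eq_bigr => w _.
by apply/malgP => v; rewrite mcoeffZ mcoeff_mono mcoeffU mulr_natr fmP.
Qed.

Lemma malg_ind (P : free K k -> Prop) :
  P 0 -> (forall c w, P (c *: mono K w)) ->
  (forall p q, P p -> P q -> P (p + q)) -> forall p, P p.
Proof. by move=> P0 PZ PD p; rewrite (malg_words p); elim/big_ind: _. Qed.

Lemma malg_scaleAl c p q : (c *: p) * q = c *: (p * q).
Proof.
transitivity (c%:MP * p * q).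
  by apply: (congr1 (fun x => x * q)); exact: esym (mul_malgC c p).
exact: etrans (esym (mulrA _ _ _)) (mul_malgC c (p * q)).
Qed.

Lemma malg_scaleAr c p q : p * (c *: q) = c *: (p * q).
Proof.
transitivity (p * (c%:MP * q)).
  by apply: (congr1 (fun x => p * x)); exact: esym (mul_malgC c q).
transitivity (p * c%:MP * q); first exact: mulrA.
transitivity ((c *: p) * q); last exact: malg_scaleAl.
apply: (congr1 (fun x => x * q)).
rewrite malgM_def fgmulgU malgZ_def.
by apply: eq_bigr => u _; rewrite mulm1 mulrC.
Qed.

(** Relations generate the ideal with arbitrary factors on both sides, while invariance of a
    function is known only for words as factors; this bridges the two. *)
Lemma malg_sandwich0 (V : lmodType K) (f : free K k -> V) (p : free K k) :
  (forall q r, f (q + r) = f q + f r) -> (forall c q, f (c *: q) = c *: f q) ->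
  (forall u v, f (mono K u * p * mono K v) = 0) -> forall a b, f (a * p * b) = 0.
Proof.
move=> fD fZ fp.
have f0 : f 0 = 0 by rewrite -[0 in LHS](scale0r 0) fZ scale0r.
apply: (sandwich0 (gen := fun x => exists c w, x = c *: mono K w)) => //.
  move=> P P0 Pg PD x; elim/malg_ind: x => // c w.
  by apply: Pg; exists c, w.
move=> _ _ [c [u ->]] [d [v ->]].
apply: etrans (congr1 f (malg_scaleAr d _ _)) _; rewrite fZ.
apply: etrans (congr1 (fun x => d *: f (x * mono K v)) (malg_scaleAl c _ _)) _.
apply: etrans (congr1 (fun x => d *: f x) (malg_scaleAl c _ _)) _.
by rewrite fZ fp !scaler0.
Qed.

Section Extension.
Variables (V : nmodType) (h : K -> word k -> V).

(** Coefficients enter through [h] and not by scaling, because [V] need not be a [K]-module: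
    polynomials in hbar will be evaluated in power series over the algebra. *)
Definition malg_ext p : V := \sum_(w <- msupp p) h p@_w w.

Hypothesis h0 : forall w, h 0 w = 0.
Hypothesis hD : forall a b w, h (a + b) w = h a w + h b w.

Lemma malg_extw (S : {fset {fmonom (letter k)}}) p : (msupp p `<=` S)%fset ->
  malg_ext p = \sum_(w <- S) h p@_w w.
Proof.
move=> pS; rewrite /malg_ext; apply: big_fset_incl => //= w _ wp.
by rewrite mcoeff_outdom.
Qed.

Lemma malg_extD p q : malg_ext (p + q) = malg_ext p + malg_ext q.
Proof.
rewrite (malg_extw (msuppD_le p q)).
rewrite (malg_extw (fsubsetUl _ (msupp q))) (malg_extw (fsubsetUr (msupp p) _)).
by rewrite -big_split /=; apply: eq_bigr => w _; rewrite mcoeffD hD.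
Qed.

Lemma malg_ext0 : malg_ext 0 = 0.
Proof. by rewrite /malg_ext msupp0 big_seq_fset0. Qed.

Lemma malg_extZ c p : malg_ext (c *: p) = \sum_(w <- msupp p) h (c * p@_w) w.
Proof.
rewrite (malg_extw (msuppZ_le c p)).
by apply: eq_bigr => w _; rewrite mcoeffZ.
Qed.

Lemma malg_extZmono c w : malg_ext (c *: mono K w) = h c w.
Proof.
by rewrite malg_extZ /mono msuppU1 big_seq_fset1 mcoeffU1 eqxx mulr1.
Qed.

Lemma malg_ext_mono w : malg_ext (mono K w) = h 1 w.
Proof. by rewrite -[mono K w]scale1r malg_extZmono. Qed.

End Extension.

End FreeAlgebra.

(** * The undeformed algebra and linear maps defined on words *)

Section Undeformed.
Variables (F : fieldType) (k : nat).
Local Notation A := (NH F k).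
Implicit Types (u v w : word k) (i : 'I_k.-1) (j : 'I_k).

Definition lo i : 'I_k := widen_ord (leq_pred k) i.
Fact hi_subproof i : (i.+1 < k)%N.
Proof. by case: i => m /=; case: k. Qed.
Definition hi i : 'I_k := Ordinal (hi_subproof i).
Definition strand i : {perm 'I_k} := tperm (lo i) (hi i).

(** Pairing of X_j with the root e_p - e_q; equivalently the divided difference of X_j for p <> q,
    and 0 for p = q. *)
Definition root_coef (p q j : 'I_k) : F := (j == p)%:R - (j == q)%:R.

(** The common undeformed part of the rules, with the three cases of sigma_i X_j merged through the
    transposition [strand i]. [WordXX] carries no order condition, since these rules are used as
    equations; termination restores the order. *)
Inductive word_rule : word k -> word k -> Prop :=
| WordSX i j : word_rule [:: sig_ i; X_ j] [:: X_ (strand i j); sig_ i]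
| WordBraid i i' : i' = i.+1 :> nat ->
    word_rule [:: sig_ i; sig_ i'; sig_ i] [:: sig_ i'; sig_ i; sig_ i']
| WordSSfar i i' : (i' + 2 <= i)%N ->
    word_rule [:: sig_ i; sig_ i'] [:: sig_ i'; sig_ i]
| WordXX j j' : word_rule [:: X_ j; X_ j'] [:: X_ j'; X_ j].

(** The constants c, -c and 0 of the rules for sigma_i X_j are c times one root coefficient. The
    ring [K] is general because the rules occur both over the field and over polynomials in hbar. *)
Lemma rule_word_rule (K : comNzRingType) (c : K) s phi : rule c s phi ->
  (exists t i j, [/\ s = [:: sig_ i; X_ j], t = [:: X_ (strand i j); sig_ i]
       & phi = mono K t + (c * ((j == lo i)%:R - (j == hi i)%:R)) *: 1]) \/
  (exists t, [/\ word_rule s t, forall i j, s <> [:: sig_ i; X_ j] & phi = mono K t]) \/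
  (exists2 i, s = [:: sig_ i; sig_ i] & phi = 0).
Proof.
case=> [i a b ai bi|i a b ai bi|i j ji ji1|i|i j ji|i j ij|i j ij].
- left; exists [:: X_ b; sig_ i], i, a.
  have -> : a = lo i by apply/val_inj.
  have -> : b = hi i by apply/val_inj.
  rewrite tpermL eqxx; split=> //.
  have /negPf -> : lo i != hi i by rewrite -val_eqE /= ltn_eqF.
  by rewrite subr0 mulr1 -mul_malgC mulr1.
- left; exists [:: X_ a; sig_ i], i, b.
  have -> : a = lo i by apply/val_inj.
  have -> : b = hi i by apply/val_inj.
  rewrite tpermR eqxx; split=> //.
  have /negPf -> : hi i != lo i by rewrite -val_eqE /= gtn_eqF.
  by rewrite sub0r mulrN1 -mul_malgC mulr1 -raddfN.
- left; exists [:: X_ j; sig_ i], i, j.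
  have jl : j != lo i by rewrite -val_eqE; apply/eqP.
  have jh : j != hi i by rewrite -val_eqE; apply/eqP.
  have -> : strand i j = j by rewrite /strand tpermD // eq_sym.
  rewrite (negPf jl) (negPf jh); split=> //.
  by rewrite subrr mulr0 scale0r addr0.
- by right; right; exists i.
- by right; left; eexists; split=> //; exact: WordBraid.
- by right; left; eexists; split=> //; exact: WordSSfar.
- by right; left; eexists; split=> //; exact: WordXX.
Qed.

Lemma rule0_word_rule (K : comNzRingType) s phi : rule (0 : K) s phi ->
  (exists2 t, word_rule s t & phi = mono K t) \/
  (exists2 i, s = [:: sig_ i; sig_ i] & phi = 0).
Proof.
move/rule_word_rule => [[t [i [j [-> -> ->]]]]|[[t [r _ ->]]|]]; last by right.
  left; exists [:: X_ (strand i j); sig_ i]; first exact: WordSX.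
  apply: etrans (congr1 (fun c : K => _ + c *: 1) (mul0r _)) _.
  by apply: etrans (congr1 (+%R _) (scale0r _)) _; exact: addr0.
by left; exists t.
Qed.

(** Evaluated on the chosen representative; linearity and the expected values on classes hold once
    [g] respects the relations. *)
Definition NH_ext (V : lmodType F) (g : word k -> V) (x : A) : V :=
  malg_ext (fun a w => a *: g w) (repr x).

Lemma cls_cat u v : cls F (u ++ v) = cls F u * cls F v.
Proof. by rewrite /cls -monoM; exact: pi_NHM. Qed.

Lemma cls_nil : cls F (k := k) [::] = 1.
Proof. by rewrite /cls /mono -fmoneE. Qed.

Lemma in_relations_word_rule s t : word_rule s t ->
  in_relations (mono F s - mono F t).
Proof.
have gen' s' t' (phi : free F k) :
    rule 0 s' phi -> phi = mono F t' -> in_relations (mono F s' - mono F t').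
  by move=> r <-; have := RelGen 1 1 r; rewrite mul1r mulr1.
have gen (s' t' : word k) : rule 0 s' (mono F t') -> in_relations (mono F s' - mono F t').
  by move=> r; exact: gen' r _.
case=> [i j|i i' ii|i i' ii|j j'].
- have [->|jl] := eqVneq j (lo i).
    rewrite tpermL.
    by apply: (gen' _ _ _ (@RuleSXl F k 0 i (lo i) (hi i) erefl erefl)); rewrite malgC0E addr0.
  have [->|jh] := eqVneq j (hi i).
    rewrite tpermR.
    by apply: (gen' _ _ _ (@RuleSXr F k 0 i (lo i) (hi i) erefl erefl)); rewrite malgC0E subr0.
  have -> : strand i j = j by rewrite /strand tpermD // eq_sym.
  apply/gen/RuleSXfar.
    by move=> e; move: jl; rewrite -val_eqE /= e eqxx.
  by move=> e; move: jh; rewrite -val_eqE /= e eqxx.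
- exact/gen/RuleBraid.
- exact/gen/RuleSSfar.
- have [jj|jj|/val_inj ->] := ltngtP j' j.
  + exact/gen/RuleXX.
  + rewrite -opprB -mulN1r; apply: in_relationsMl; exact/gen/RuleXX.
  + by rewrite subrr; exact: Rel0.
Qed.

Lemma cls_word_rule s t : word_rule s t -> cls F s = cls F t.
Proof. by move=> r; apply/eqP/NH_eqP; exact: in_relations_word_rule. Qed.

Lemma cls_sigsig i : cls F [:: sig_ i; sig_ i] = 0.
Proof.
rewrite -(pi_NH0 F k); apply/eqP/NH_eqP.
by have := @RelGen F k _ _ 1 1 (@RuleSS F k 0 i); rewrite mul1r mulr1.
Qed.

Section Lift.
Variables (V : lmodType F) (g : word k -> V).
Hypothesis g_rule : forall u v s t, word_rule s t -> g (u ++ s ++ v) = g (u ++ t ++ v).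
Hypothesis g_sq : forall u v i, g (u ++ [:: sig_ i; sig_ i] ++ v) = 0.

Let ext := malg_ext (fun a w => a *: g w).

Let extD : forall p q, ext (p + q) = ext p + ext q.
Proof. by apply: malg_extD => [w|a b w]; rewrite ?scale0r ?scalerDl. Qed.

Let extZ c p : ext (c *: p) = c *: ext p.
Proof.
rewrite /ext malg_extZ => [|w]; last by rewrite scale0r.
by rewrite scaler_sumr; apply: eq_bigr => w _; rewrite scalerA.
Qed.

Let ext_mono w : ext (mono F w) = g w.
Proof. by rewrite /ext malg_ext_mono ?scale1r // => u; rewrite scale0r. Qed.

Let ext_relations p : in_relations p -> ext p = 0.
Proof.
elim=> [s phi a b r||x y _ hx _ hy].
- apply: (malg_sandwich0 extD extZ) => u v.
  have extB p' q : ext (p' - q) = ext p' - ext q.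
    apply: etrans (congr1 (fun x => ext (p' + x)) (esym (scaleN1r q))) _.
    by rewrite extD extZ scaleN1r.
  case: (rule0_word_rule r) => [[t r' ->]|[i -> ->]].
  + apply: etrans (congr1 ext (mono_sandwichB F u v s t)) _.
    by rewrite extB !ext_mono (g_rule u v r') subrr.
  + apply: etrans (congr1 (fun x => ext (mono F u * x * mono F v)) (subr0 _)) _.
    by rewrite mono3 ext_mono g_sq.
- exact: malg_ext0.
- by rewrite extD hx hy addr0.
Qed.

Let ext_pi p : NH_ext g (\pi_A p) = ext p.
Proof.
apply/eqP; rewrite -subr_eq0 -scaleN1r -extZ -extD.
apply/eqP/ext_relations; rewrite scaleN1r -opprB -mulN1r.
exact/in_relationsMl/in_relations_repr.
Qed.

Lemma NH_ext_is_linear : linear (NH_ext g).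
Proof.
move=> c x y; case: (NH_surj x) => p ->; case: (NH_surj y) => q ->.
have -> : c *: (\pi_A p : A) + (\pi_A q : A) = \pi_A (c *: p + q).
  by rewrite pi_NHD pi_NHZ.
by rewrite !ext_pi extD extZ.
Qed.

Lemma NH_ext_cls w : NH_ext g (cls F w) = g w.
Proof. by rewrite ext_pi ext_mono. Qed.

End Lift.

Lemma NH_words (x : A) : x = \sum_(w <- msupp (repr x)) (repr x)@_w *: cls F w.
Proof.
rewrite -{1}(reprK x) [in LHS](malg_words (repr x)).
rewrite (big_morph _ (@pi_NHD F k) (pi_NH0 F k)).
by apply: eq_bigr => w _; rewrite pi_NHZ.
Qed.

End Undeformed.

(** Exactly the functions on words that descend to linear maps on the algebra; [nlift] is the
    descent. *)
Definition rule_invariant (k : nat) (V : nmodType) (g : word k -> V) : Prop :=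
  (forall u v s t, word_rule s t -> g (u ++ s ++ v) = g (u ++ t ++ v)) /\
  (forall u v i, g (u ++ [:: sig_ i; sig_ i] ++ v) = 0).

(* What is used of the algebra [NH], kept abstract: comparing two products in [NH]
   itself by conversion unfolds the quotient. *)
Structure nh_algebra (F : fieldType) (k : nat) := NHAlgebra {
  nh_sort :> algType F;
  ncls : word k -> nh_sort;
  nhomog : int * int -> nh_sort -> Prop;
  nlift : (word k -> nh_sort) -> nh_sort -> nh_sort;
  ncls_nil : ncls [::] = 1;
  ncls_cat : forall u v, ncls (u ++ v) = ncls u * ncls v;
  ncls_rule : forall s t, word_rule s t -> ncls s = ncls t;
  ncls_sq : forall i, ncls [:: sig_ i; sig_ i] = 0;
  ncls_ind : forall P : nh_sort -> Prop,
    P 0 -> (forall w, P (ncls w)) ->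
    (forall c x y, P x -> P y -> P (c *: x + y)) -> forall x, P x;
  nhomog_ind : forall (P : nh_sort -> Prop) d,
    P 0 -> (forall w, word_deg w = d -> P (ncls w)) ->
    (forall c x y, P x -> P y -> P (c *: x + y)) -> forall x, nhomog d x -> P x;
  nhomog0 : forall d, nhomog d 0;
  nhomog_cls : forall w, nhomog (word_deg w) (ncls w);
  nhomogL : forall d c x y, nhomog d x -> nhomog d y -> nhomog d (c *: x + y);
  nlift_linear : forall g, rule_invariant g -> linear (nlift g);
  nlift_cls : forall g, rule_invariant g -> forall w, nlift g (ncls w) = g w
}.

(** * Divided differences *)

Section DividedDifference.
Variables (F : fieldType) (k : nat) (A : nh_algebra F k).
Local Notation cls := (@ncls F k A).
Local Notation "'x_ j" := (cls [:: X_ j]) (at level 8, j at level 2).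
Local Notation "'s_ i" := (cls [:: sig_ i]) (at level 8, i at level 2).
Local Notation rho := (root_coef F).
Implicit Types (p q r j : 'I_k) (i : 'I_k.-1) (a : A) (u v w : word k).

Lemma tperm_perm (s : {perm 'I_k}) p q j : tperm (s p) (s q) (s j) = s (tperm p q j).
Proof. by rewrite (inj_tperm _ _ _ (@perm_inj _ s)). Qed.

Lemma strandK i : involutive (strand i).
Proof. by move=> j; rewrite /strand tpermK. Qed.

Lemma root_strand i p q j : rho (strand i p) (strand i q) j = rho p q (strand i j).
Proof. by rewrite /root_coef !(inv_eq (strandK i)). Qed.

Lemma tperm_strand i p q j :
  strand i (tperm (strand i p) (strand i q) j) = tperm p q (strand i j).
Proof. by rewrite -tperm_perm !strandK. Qed.

Lemma lo_next i i' : i' = i.+1 :> nat -> lo i' = hi i.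
Proof. by move=> ii; exact/val_inj. Qed.

Lemma lo_neq_hi i : lo i != hi i.
Proof. by rewrite -val_eqE /= ltn_eqF. Qed.

Lemma strand_hi_next i i' : i' = i.+1 :> nat -> strand i (hi i') = hi i'.
Proof. by move=> ii; rewrite /strand tpermD // -val_eqE /= ii; lia. Qed.

Lemma strand_lo_next i i' : i' = i.+1 :> nat -> strand i' (lo i) = lo i.
Proof. by move=> ii; rewrite /strand tpermD // -val_eqE /= ii; lia. Qed.

(** Both sides are conjugates of an adjacent transposition, equal to the transposition of [lo i] and
    [hi i']. *)
Lemma strand_braid i i' j : i' = i.+1 :> nat ->
  strand i (strand i' (strand i j)) = strand i' (strand i (strand i' j)).
Proof.
move=> ii; transitivity (tperm (lo i) (hi i') j).
  apply: etrans (esym (tperm_perm (strand i) (lo i') (hi i') _)) _.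
  by rewrite strandK (lo_next ii) [strand i (hi i)]tpermR strand_hi_next.
apply: etrans _ (tperm_perm (strand i') (lo i) (hi i) _).
by rewrite strandK -(lo_next ii) [strand i' (lo i')]tpermL strand_lo_next.
Qed.

Lemma strand_far i i' j : (i' + 2 <= i)%N ->
  strand i (strand i' j) = strand i' (strand i j).
Proof.
move=> ii; apply: etrans _ (tperm_perm (strand i') (lo i) (hi i) j).
congr (tperm _ _ _).
  by rewrite /strand tpermD // -val_eqE /=; lia.
by rewrite /strand tpermD // -val_eqE /=; lia.
Qed.

Lemma cls_cons l w : cls (l :: w) = cls [:: l] * cls w.
Proof. by rewrite -ncls_cat. Qed.

Lemma cls_letter_ind (P : A -> Prop) :
  P 1 -> (forall j x, P x -> P ('x_ j * x)) -> (forall i x, P x -> P ('s_ i * x)) ->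
  (forall c x y, P x -> P y -> P (c *: x + y)) -> forall x, P x.
Proof.
move=> P1 PX Ps PL; apply: ncls_ind => //.
  by rewrite -[0](subrr 1) addrC -scaleN1r; exact: PL.
elim=> [|[j|i] w IH]; first by rewrite ncls_nil.
  by rewrite cls_cons; exact: PX.
by rewrite cls_cons; exact: Ps.
Qed.

Lemma linear_cls_eq (V : lmodType F) (f g : A -> V) : linear f -> linear g ->
  (forall w, f (cls w) = g (cls w)) -> f =1 g.
Proof.
move=> fl gl fg; apply: ncls_ind => // [|c x y fx fy]; last by rewrite fl gl fx fy.
have f0 h : linear h -> h 0 = 0 :> V.
  by move=> hl; have := hl (-1) 0 0; rewrite scaler0 addr0 scaleN1r addNr.
by rewrite !f0.
Qed.

Lemma sigX i j : 's_ i * 'x_ j = 'x_ (strand i j) * 's_ i.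
Proof. by rewrite -!ncls_cat; exact/ncls_rule/WordSX. Qed.

Lemma XX j j' : 'x_ j * 'x_ j' = 'x_ j' * 'x_ j.
Proof. by rewrite -!ncls_cat; exact/ncls_rule/WordXX. Qed.

Lemma sig_sig i : 's_ i * 's_ i = 0.
Proof. by rewrite -ncls_cat; exact: ncls_sq. Qed.

Lemma sig_far i i' : (i' + 2 <= i)%N -> 's_ i * 's_ i' = 's_ i' * 's_ i.
Proof. by move=> ii; rewrite -!ncls_cat; exact/ncls_rule/WordSSfar. Qed.

Lemma sig_braid i i' : i' = i.+1 :> nat ->
  's_ i * 's_ i' * 's_ i = 's_ i' * 's_ i * 's_ i'.
Proof. by move=> ii; rewrite -!ncls_cat; exact/ncls_rule/WordBraid. Qed.

(* For w = f(X) sigma this is ((f - s_pq f) / (X_p - X_q)) sigma.  All pairs p, q are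
   needed, since moving a difference past sigma_i permutes its indices. *)
Fixpoint ddw (w : word k) (p q : 'I_k) : A :=
  match w with
  | [::] => 0
  | inl j :: w' => 'x_ (tperm p q j) * ddw w' p q + rho p q j *: cls w'
  | inr i :: w' => 's_ i * ddw w' (strand i p) (strand i q)
  end.

(** Equality of classes is assumed as well because the Leibniz term contains the undifferentiated
    tail. *)
Lemma ddw_cat u w w' : (forall p q, ddw w p q = ddw w' p q) ->
  cls w = cls w' -> forall p q, ddw (u ++ w) p q = ddw (u ++ w') p q.
Proof.
move=> ww' cww'; elim: u => [|[j|i] u IH] p q; rewrite ?cat0s ?ww' //=.
  by rewrite IH !ncls_cat cww'.
by rewrite IH.
Qed.

(** By the reflection formula s_pq X_j = X_j - rho_j (X_p - X_q), both sides equal rho_j' X_j +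
    rho_j X_j' - rho_j rho_j' (X_p - X_q). This is the compatibility of the Leibniz rule with X_j
    X_j' = X_j' X_j. *)
Lemma root_diff p q j j' :
  rho p q j' *: 'x_ (tperm p q j) + rho p q j *: 'x_ j' =
  rho p q j *: 'x_ (tperm p q j') + rho p q j' *: 'x_ j.
Proof.
have d m : 'x_ (tperm p q m) = 'x_ m - rho p q m *: ('x_ p - 'x_ q).
  rewrite /root_coef; case: tpermP => [->|->|/eqP/negPf -> /eqP/negPf ->].
  - have [->|_] := eqVneq p q; first by rewrite subrr scaler0 subr0.
    by rewrite eqxx subr0 scale1r opprB addrC subrK.
  - have [->|_] := eqVneq q p; first by rewrite subrr scaler0 subr0.
    by rewrite eqxx sub0r scaleN1r opprK addrC subrK.
  - by rewrite subrr scale0r subr0.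
rewrite !d; set y := _ - 'x_ q; rewrite !(scalerBr _ _ (_ *: y)) !scalerA.
rewrite [rho p q j * _]mulrC addrAC [RHS]addrAC.
by rewrite [_ *: _ + _ *: 'x_ j]addrC.
Qed.

Lemma ddw_rule s t v : word_rule s t -> forall p q, ddw (s ++ v) p q = ddw (t ++ v) p q.
Proof.
case=> [i j|i i' ii|i i' ii|j j'] p q /=.
- rewrite mulrDr mulrA sigX tperm_strand -mulrA root_strand -scalerAr.
  by rewrite [cls (_ :: v)]cls_cons.
- by rewrite !mulrA (sig_braid ii) !(strand_braid _ ii).
- by rewrite !mulrA (sig_far ii) !(strand_far _ ii).
- rewrite !mulrDr !mulrA XX -!addrA; congr (_ + _).
  rewrite -!scalerAr.
  rewrite ![cls (_ :: v)]cls_cons !scalerAl -!mulrDl.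
  by rewrite root_diff.
Qed.

Lemma ddw_sq i v p q : ddw ([:: sig_ i; sig_ i] ++ v) p q = 0.
Proof. by rewrite /= mulrA sig_sig mul0r. Qed.

Lemma ddw_rule_cat p q u v s t :
  word_rule s t -> ddw (u ++ s ++ v) p q = ddw (u ++ t ++ v) p q.
Proof.
move=> r; apply: ddw_cat => [|]; first exact: ddw_rule.
by rewrite !ncls_cat (ncls_rule A r).
Qed.

Lemma ddw_sq_cat p q u v i : ddw (u ++ [:: sig_ i; sig_ i] ++ v) p q = 0.
Proof.
have cls0 u' : cls (u' ++ [:: sig_ i; sig_ i] ++ v) = 0.
  by rewrite ncls_cat (ncls_cat A [:: sig_ i; sig_ i]) ncls_sq mul0r mulr0.
move: ([:: _; _] ++ v) cls0 (ddw_sq i v) => w cls0 w0.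
elim: u p q => [|[j|i'] u IH] p q /=; first exact: w0.
  by rewrite IH cls0 mulr0 scaler0 addr0.
by rewrite IH mulr0.
Qed.

Lemma ddw_invariant p q : rule_invariant (fun w => ddw w p q).
Proof. by split=> *; [exact: ddw_rule_cat | exact: ddw_sq_cat]. Qed.

Definition dd (p q : 'I_k) : A -> A := nlift (fun w => ddw w p q).

HB.instance Definition _ p q := GRing.isLinear.Build F A A *:%R (dd p q)
  (nlift_linear (ddw_invariant p q)).

Lemma dd_cls p q w : dd p q (cls w) = ddw w p q.
Proof. exact: (nlift_cls (ddw_invariant p q)). Qed.

Lemma dd1 p q : dd p q 1 = 0.
Proof. by rewrite -ncls_nil dd_cls. Qed.

(** Twisted Leibniz rule. Together with [dd1], [ddS] and linearity it determines the divided
    differences, so that the identities between them are proved by induction on letters. *)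
Lemma ddX p q j a : dd p q ('x_ j * a) =
  'x_ (tperm p q j) * dd p q a + rho p q j *: a.
Proof.
pose f a := dd p q ('x_ j * a).
pose g a := 'x_ (tperm p q j) * dd p q a + rho p q j *: a.
apply: (linear_cls_eq (f := f) (g := g)) => [c x y|c x y|w]; rewrite /f /g.
- by rewrite mulrDr -scalerAr linearP.
- rewrite linearP mulrDr -scalerAr scalerDr !scalerDr !scalerA [_ * c]mulrC.
  by rewrite addrACA.
- by rewrite -cls_cons !dd_cls.
Qed.

Lemma ddS p q i a : dd p q ('s_ i * a) = 's_ i * dd (strand i p) (strand i q) a.
Proof.
pose f a := dd p q ('s_ i * a).
pose g a := 's_ i * dd (strand i p) (strand i q) a.
apply: (linear_cls_eq (f := f) (g := g)) => [c x y|c x y|w]; rewrite /f /g.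
- by rewrite mulrDr -scalerAr linearP.
- by rewrite linearP mulrDr -scalerAr.
- by rewrite -cls_cons !dd_cls.
Qed.

(** A product of sigma letters has polynomial part 1, which every divided difference kills. *)
Lemma dd_sigs p q ss : dd p q (cls (map (@sig_ k) ss)) = 0.
Proof. by rewrite dd_cls; elim: ss p q => //= i ss IH p q; rewrite IH mulr0. Qed.

Lemma root_opp p q j : rho q p j = - rho p q j.
Proof. by rewrite /root_coef opprB. Qed.

Lemma root_tperm p q j : rho p q (tperm p q j) = - rho p q j.
Proof.
rewrite /root_coef opprB.
have -> : (tperm p q j == p) = (j == q) by rewrite (inv_eq (tpermK p q)) tpermL.
by have -> : (tperm p q j == q) = (j == p) by rewrite (inv_eq (tpermK p q)) tpermR.
Qed.

Lemma dd_opp p q a : dd q p a = - dd p q a.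
Proof.
move: p q; elim/cls_letter_ind: a => [|j a IH|i a IH|c a b IHa IHb] p q.
- by rewrite !dd1 oppr0.
- by rewrite !ddX IH tpermC root_opp mulrN scaleNr opprD.
- by rewrite !ddS IH mulrN.
- by rewrite !(linearP (dd _ _)) /= IHa IHb opprD scalerN.
Qed.

(** A divided difference is symmetric in X_p and X_q. In the induction the two Leibniz terms cancel
    because the root coefficient changes sign under the transposition. *)
Lemma dd_dd p q a : dd p q (dd p q a) = 0.
Proof.
move: p q; elim/cls_letter_ind: a => [|j a IH|i a IH|c a b IHa IHb] p q.
- by rewrite dd1 linear0.
- rewrite !ddX linearD linearZ /= !ddX IH mulr0 add0r.
  by rewrite root_tperm scaleNr addNr.
- by rewrite !ddS IH mulr0.
- by rewrite !linearP /= IHa IHb scaler0 addr0.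
Qed.

Lemma root_disjoint p q p' q' j : p != p' -> p != q' -> q != p' -> q != q' ->
  rho p q (tperm p' q' j) = rho p q j.
Proof.
move=> pp pq qp qq; rewrite /root_coef !(inv_eq (tpermK p' q')).
by rewrite (tpermD (z := p)) 1?(tpermD (z := q)) // eq_sym.
Qed.

Lemma dd_disjoint p q p' q' a : p != p' -> p != q' -> q != p' -> q != q' ->
  dd p q (dd p' q' a) = dd p' q' (dd p q a).
Proof.
move: p q p' q'.
elim/cls_letter_ind: a => [|j a IH|i a IH|c a b IHa IHb] p q p' q' pp pq qp qq.
- by rewrite !dd1 !linear0.
- rewrite !ddX !linearD !linearZ /= !ddX IH //.
  rewrite !root_disjoint // 1?eq_sym // -!addrA; congr (_ * _ + _).
    congr (cls [:: X_ _]); rewrite -[in RHS]tperm_perm.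
    by rewrite (tpermD (z := p)) 1?(tpermD (z := q)) // eq_sym.
  by rewrite addrC.
- by rewrite !ddS IH // (inj_eq perm_inj).
- by rewrite !linearP /= IHa // IHb.
Qed.

Lemma root_cycle p q r j : p != q -> q != r -> r != p ->
  rho p q (tperm q r j) + rho r p j = 0.
Proof.
move=> pq qr rp; rewrite /root_coef !(inv_eq (tpermK q r)) tpermL.
have -> : tperm q r p = p by rewrite tpermD // eq_sym.
by rewrite addrA subrK subrr.
Qed.

Lemma tperm_cycle p q r j : p != q -> q != r -> r != p ->
  tperm p q (tperm q r j) = tperm q r (tperm r p j).
Proof.
move=> pq qr rp; rewrite -[in RHS]tperm_perm tpermR.
have -> : tperm q r p = p by rewrite tpermD // eq_sym.
by rewrite tpermC.
Qed.

Fact add_cyclic (V : zmodType) (x y z b c d : V) :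
  (x + b - c) + (y + d - b) + (z + c - d) = x + y + z.
Proof.
rewrite -!(addrA _ _ (- _)) (addrACA x) (addrACA (x + y)) [b - c + _]addrC.
by rewrite [d - b + _]addrA subrK [d - c + _]addrA subrK subrr addr0.
Qed.

(** The products s_pq s_qr, s_qr s_rp and s_rp s_pq are the same 3-cycle, so the leading terms share
    the factor X_t and combine by induction. The six Leibniz remainders cancel cyclically by
    [root_cycle]. *)
Lemma dd_yang_baxter p q r a : p != q -> q != r -> r != p ->
  dd p q (dd q r a) + dd q r (dd r p a) + dd r p (dd p q a) = 0.
Proof.
move: p q r; elim/cls_letter_ind: a => [|j a IH|i a IH|c a b IHa IHb] p q r pq qr rp.
- by rewrite !dd1 !linear0 !addr0.
- rewrite !ddX !linearD !linearZ /= !ddX.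
  rewrite -(tperm_cycle _ pq qr rp) -(tperm_cycle _ rp pq qr).
  set t := tperm p q _; set a1 := dd p q _; set a2 := dd q r _.
  set a3 := dd r p _.
  have {IH} := IH _ _ _ pq qr rp; rewrite -/a1 -/a2 -/a3 => IH.
  have e1 := root_cycle j pq qr rp.
  have e2 := root_cycle j qr rp pq.
  have e3 := root_cycle j rp pq qr.
  rewrite -(addr0_eq e1) -(addr0_eq e2) -(addr0_eq e3).
  rewrite !scaleNr add_cyclic -/t -!mulrDr.
  by rewrite IH mulr0.
- by rewrite !ddS -!mulrDr IH ?mulr0 // (inj_eq perm_inj).
- rewrite !(linearP (dd _ _)) /= (addrACA (c *: _) _ (c *: _)).
  rewrite (addrACA (_ + _) _ (c *: _)).
  by rewrite -!scalerDr IHa // IHb // scaler0 addr0.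
Qed.

End DividedDifference.

(** * Power series and linear maps over the power series ring *)

Section Series.
Variables (F : fieldType) (V W : lmodType F).
Implicit Types (f g : nat -> V) (T : (nat -> V) -> (nat -> W)).

Definition fconst (U : nmodType) (a : U) : nat -> U := fun n => if n is 0 then a else 0.
(* Multiplication by hbar. *)
Definition fshift (U : nmodType) (f : nat -> U) : nat -> U :=
  fun n => if n is m.+1 then f m else 0.
Definition ftail (U : nmodType) (f : nat -> U) : nat -> U := fun n => f n.+1.

Lemma fps_split (U : nmodType) (f : nat -> U) : f = fconst (f 0%N) + fshift (ftail f).
Proof. by apply/funext => -[|n]; rewrite !fctE /= ?addr0 ?add0r. Qed.

(** Compatibility with hbar is enough for linearity over all power series, see [hlinear_gscale]: a
    coefficient of T f depends only on finitely many coefficients of f. *)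
Definition hlinear T : Prop := linear T /\ forall f, T (fshift f) = fshift (T f).

Lemma hlinearD T f g : hlinear T -> T (f + g) = T f + T g.
Proof. by case=> Tl _; rewrite -[f in LHS]scale1r Tl scale1r. Qed.

Lemma hlinear0 T : hlinear T -> T 0 = 0.
Proof. by move=> /hlinearD TD; apply: (addrI (T 0)); rewrite -TD !addr0. Qed.

Lemma hlinearZ T c f : hlinear T -> T (c *: f) = c *: T f.
Proof. by move=> Th; have [Tl _] := Th; rewrite -[c *: f]addr0 Tl hlinear0 // addr0. Qed.

Lemma hlinear_shift T f : hlinear T -> T (fshift f) = fshift (T f).
Proof. by case. Qed.

(** Coefficient n is settled by the constant term of the series and by coefficient n - 1 of the
    value at its tail; no topology enters. *)
Lemma hlinear_eq T T' : hlinear T -> hlinear T' ->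
  (forall a, T (fconst a) = T' (fconst a)) -> T =1 T'.
Proof.
move=> Th Th' TT' f; apply/funext => n; elim: n f => [|n IH] f;
  rewrite (fps_split f) !hlinearD // TT' !hlinear_shift // !fctE //=.
by rewrite IH.
Qed.

(** The sum of hbar^m G (f m) over m, computed by splitting off the constant term. *)
Fixpoint fext (G : V -> nat -> W) f n : W :=
  G (f 0%N) n + if n is m.+1 then fext G (ftail f) m else 0.

Lemma fextE G f : fext G f = G (f 0%N) + fshift (fext G (ftail f)).
Proof. by apply/funext => -[|n]. Qed.

Lemma hlinear_fext G : linear G -> hlinear (fext G).
Proof.
move=> Gl; split=> [c f g|f].
  apply/funext => n; change (fext G (c *: f + g) n = c *: fext G f n + fext G g n).
  elim: n f g => [|n IH] f g /=; rewrite [(_ + _) 0%N]/(c *: f 0%N + g 0%N) Gl.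
    by rewrite !addr0.
  by rewrite scalerDr addrACA -IH.
have G0 : G 0 = 0.
  by have := Gl (-1) 0 0; rewrite scaler0 addr0 scaleN1r addNr.
by rewrite fextE /= G0 add0r.
Qed.

Lemma fext_const G a : linear G -> fext G (fconst a) = G a.
Proof.
move=> Gl; have -> : fext G (fconst a) = G a + fshift (fext G 0) by rewrite fextE.
rewrite (hlinear0 (hlinear_fext Gl)).
by apply/funext => -[|n]; rewrite fctE /= addr0.
Qed.

Lemma fshiftD (U : lmodType F) (f g : nat -> U) : fshift (f + g) = fshift f + fshift g.
Proof. by apply/funext => -[|n]; rewrite !fctE /= ?addr0. Qed.

Lemma fshiftZ (U : lmodType F) c (f : nat -> U) : fshift (c *: f) = c *: fshift f.
Proof. by apply/funext => -[|n]; rewrite !fctE /= ?scaler0. Qed.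

Lemma fshift0 (U : lmodType F) : fshift (0 : nat -> U) = 0.
Proof. by apply/funext => -[|n]. Qed.

Lemma fconstL (U : lmodType F) c (a b : U) : fconst (c *: a + b) = c *: fconst a + fconst b.
Proof. by apply/funext => -[|n]; rewrite !fctE /= ?scaler0 ?addr0. Qed.

Lemma hlinear_pointwise (G : V -> W) : linear G -> hlinear (fun f n => G (f n)).
Proof.
move=> Gl; split=> [c f g|f]; apply/funext => n; first by rewrite !fctE Gl.
have G0 : G 0 = 0.
  by have := Gl (-1) 0 0; rewrite scaler0 addr0 scaleN1r addNr.
by case: n.
Qed.

Lemma pointwise_const (G : V -> W) a : linear G ->
  (fun n => G (fconst a n)) = fconst (G a).
Proof.
move=> Gl; apply/funext => -[|n] //=.
by have := Gl (-1) 0 0; rewrite scaler0 addr0 scaleN1r addNr.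
Qed.

Lemma hlinear_add T T' c : hlinear T -> hlinear T' ->
  hlinear (fun f => T f + c *: T' f).
Proof.
move=> Th Th'; split=> [d f g|f].
  rewrite !hlinearD // !hlinearZ // !scalerDr !scalerA [d * c]mulrC.
  by rewrite addrACA.
by rewrite !hlinear_shift // fshiftD fshiftZ.
Qed.

End Series.

Section SeriesComp.
Variables (F : fieldType) (U V W : lmodType F).

Lemma hlinear_comp (T : (nat -> V) -> (nat -> W)) (T' : (nat -> U) -> (nat -> V)) :
  hlinear T -> hlinear T' -> hlinear (T \o T').
Proof.
move=> Th Th'; split=> [c f g|f] /=; last by rewrite !hlinear_shift.
by rewrite !hlinearD ?hlinearZ.
Qed.

Lemma hlinear_id : hlinear (@id (nat -> U)).
Proof. by []. Qed.

Lemma hlinear_fshift : hlinear (@fshift U).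
Proof. by split=> [c f g|f] //; rewrite fshiftD fshiftZ. Qed.

End SeriesComp.

(** * Representations of the deformed relations *)

Section Representations.
Variables (F : fieldType) (k : nat) (A : nh_algebra F k).
Local Notation cls := (@ncls F k A).
Local Notation "'x_ j" := (cls [:: X_ j]) (at level 8, j at level 2).
Local Notation "'s_ i" := (cls [:: sig_ i]) (at level 8, i at level 2).
Local Notation rho := (root_coef F).
Local Notation V := (nat -> A).
Implicit Types (j : 'I_k) (i : 'I_k.-1) (b : A) (u v : V) (w : word k).

Record nh_rep (a : F) (x : 'I_k -> V -> V) (s : 'I_k.-1 -> V -> V) : Prop := NHRep {
  rep_hlinX : forall j, hlinear (x j);
  rep_hlinS : forall i, hlinear (s i);
  rep_XX : forall j j' v, x j (x j' v) = x j' (x j v);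
  rep_SS : forall i v, s i (s i v) = 0;
  rep_far : forall i i' v, (i' + 2 <= i)%N -> s i (s i' v) = s i' (s i v);
  rep_braid : forall i i' v, i' = i.+1 :> nat ->
    s i (s i' (s i v)) = s i' (s i (s i' v));
  rep_SX : forall i j v,
    s i (x j v) = x (strand i j) (s i v) + (a * rho (lo i) (hi i) j) *: fshift v
}.

(** The undeformed relations move every X_j to the left of all sigma letters without a remainder.
    This spanning statement takes the place of a basis. *)
Lemma sorted_ind (P : A -> Prop) :
  (forall ss, P (cls (map (@sig_ k) ss))) -> (forall j b, P b -> P ('x_ j * b)) ->
  (forall c b b', P b -> P b' -> P (c *: b + b')) -> forall b, P b.
Proof.
move=> PS PX PL.
have sorted w : exists xs ss, cls w = cls (map (@X_ k) xs ++ map (@sig_ k) ss).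
  elim: w => [|[j|i] w [xs [ss IH]]]; first by exists [::], [::].
    by exists (j :: xs), ss; rewrite cls_cons IH -cls_cons.
  exists (map (strand i) xs), (i :: ss); rewrite cls_cons IH.
  elim: xs {IH} => [|j xs IH]; first by rewrite -cls_cons.
  by rewrite /= (cls_cons A (X_ j)) mulrA sigX -mulrA IH -cls_cons.
apply: ncls_ind => // [|w].
  by rewrite -[0](subrr (cls [::])) addrC -scaleN1r; apply: PL; exact: PS [::].
case: (sorted w) => xs [ss ->].
by elim: xs => [|j xs IH]; [exact: PS | rewrite cls_cons; exact: PX].
Qed.

Section Action.
Variables (x : 'I_k -> V -> V) (s : 'I_k.-1 -> V -> V).

(** The index map [f] records the permutation of the sigma letters already passed, which an X_j met
    later has to cross. *)
Fixpoint xpart w (f : 'I_k -> 'I_k) v : V :=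
  match w with
  | [::] => v
  | inl j :: w' => x (f j) (xpart w' f v)
  | inr i :: w' => xpart w' (f \o strand i) v
  end.

Fixpoint spart w v : V :=
  match w with
  | [::] => v
  | inl _ :: w' => spart w' v
  | inr i :: w' => s i (spart w' v)
  end.

(* The word [w] acts through its normal form, in which the letters X_j have been
   moved to the left past the sigma_i by the undeformed relations. *)
Definition sorted_act w v : V := xpart w id (spart w v).

(** Linear in [b], but in general not multiplicative for the undeformed product; [act_S] measures
    the failure. *)
Definition act b v : V := fun n => nlift (fun w => sorted_act w v n) b.

Variables (a : F) (xs_rep : nh_rep a x s).

Lemma hlinear_xpart w f : hlinear (xpart w f).
Proof.
elim: w f => [|[j|i] w IH] f; [exact: (hlinear_id A) | | exact: IH].
exact: hlinear_comp (rep_hlinX xs_rep (f j)) (IH f).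
Qed.

Lemma hlinear_spart w : hlinear (spart w).
Proof.
elim: w => [|[j|i] w IH]; [exact: (hlinear_id A) | exact: IH |].
exact: hlinear_comp (rep_hlinS xs_rep i) IH.
Qed.

Lemma hlinear_sorted_act w : hlinear (sorted_act w).
Proof. exact: hlinear_comp (hlinear_xpart w id) (hlinear_spart w). Qed.

Lemma xpart_cat p w w' : (forall f v, xpart w f v = xpart w' f v) ->
  forall f v, xpart (p ++ w) f v = xpart (p ++ w') f v.
Proof. by move=> ww'; elim: p => [|[j|i] p IH] f v //=; rewrite IH. Qed.

Lemma spart_cat w w' v : spart (w ++ w') v = spart w (spart w' v).
Proof. by elim: w => [|[j|i] w IH] //=; rewrite IH. Qed.

Lemma xpart_rule p q t w f v : word_rule p q ->
  xpart (t ++ p ++ w) f v = xpart (t ++ q ++ w) f v.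
Proof.
move=> r; apply: xpart_cat => {}f {}v.
case: r => [i j|i i' ii|i i' ii|j j'] //=; last exact: (rep_XX xs_rep).
  by congr (xpart w _ v); apply/funext => j /=; rewrite strand_braid.
by congr (xpart w _ v); apply/funext => j /=; rewrite strand_far.
Qed.

Lemma spart_rule p q t w v : word_rule p q ->
  spart (t ++ p ++ w) v = spart (t ++ q ++ w) v.
Proof.
move=> r; rewrite !spart_cat; congr (spart t _).
case: r => [i j|i i' ii|i i' ii|j j'] //=; first exact: (rep_braid xs_rep).
exact: (rep_far xs_rep).
Qed.

(** [xpart] sees the sigma letters only as permutations and [spart] sees only the operators s_i, so
    each relation is checked on both. The rule for sigma_i X_j changes neither part, and sigma_i^2
    acts by zero through [spart]. *)
Lemma sorted_act_invariant v n : rule_invariant (fun w => sorted_act w v n).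
Proof.
split=> [t w p q r|t w i]; rewrite /sorted_act.
  by rewrite (xpart_rule _ _ _ _ r) (spart_rule _ _ _ r).
rewrite !spart_cat /= (rep_SS xs_rep) (hlinear0 (hlinear_spart t)).
by rewrite (hlinear0 (hlinear_xpart _ _)).
Qed.

Lemma act_linear v : linear (act^~ v).
Proof.
move=> c b b'; apply/funext => n; rewrite !fctE.
exact: (nlift_linear (sorted_act_invariant v n)).
Qed.

Lemma act_cls w v : act (cls w) v = sorted_act w v.
Proof.
apply/funext => n; exact: (nlift_cls (sorted_act_invariant v n)).
Qed.

Lemma act0 v : act 0 v = 0.
Proof. by have := act_linear v (-1) 0 0; rewrite scaler0 addr0 scaleN1r addNr. Qed.

Lemma actL c b b' v : act (c *: b + b') v = c *: act b v + act b' v.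
Proof. exact: act_linear. Qed.

Lemma hlinear_act b : hlinear (act b).
Proof.
elim/ncls_ind: b => [|w|c b b' bh b'h].
- have -> : act 0 = fun=> 0 by apply/funext => v; exact: act0.
  by split=> [c f g|f]; rewrite ?scaler0 ?addr0 ?fshift0.
- have -> : act (cls w) = sorted_act w by apply/funext => v; exact: act_cls.
  exact: hlinear_sorted_act.
- have -> : act (c *: b + b') = fun v => act b' v + c *: act b v.
    by apply/funext => v; rewrite actL addrC.
  exact: hlinear_add.
Qed.

Lemma act_nil v : act 1 v = v.
Proof. by rewrite -(ncls_nil A) act_cls. Qed.

Lemma act_X j b v : act ('x_ j * b) v = x j (act b v).
Proof.
have xh := rep_hlinX xs_rep j.
apply: (linear_cls_eq (f := fun b => act ('x_ j * b) v) (g := fun b => x j (act b v))).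
- by move=> c b1 b2; rewrite mulrDr -scalerAr actL.
- by move=> c b1 b2; rewrite actL (hlinearD _ _ xh) (hlinearZ _ _ xh).
- by move=> w; rewrite -cls_cons !act_cls.
Qed.

Lemma act_sig i ss v : act ('s_ i * cls (map (@sig_ k) ss)) v =
  s i (act (cls (map (@sig_ k) ss)) v).
Proof.
rewrite -cls_cons !act_cls /sorted_act.
have xsig ss' f u : xpart (map (@sig_ k) ss') f u = u by elim: ss' f => //=.
by rewrite (xsig (i :: ss)) xsig.
Qed.

(** Moving s_i across the polynomial part of [b] by the deformed relation leaves one root
    coefficient per X_j; by the Leibniz rule these add up to the divided difference of [b]. This
    identity dictates the form of [model_S]. *)
Lemma act_S i b v : act ('s_ i * b) v + a *: fshift (act (dd (lo i) (hi i) b) v) =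
  s i (act b v).
Proof.
elim/sorted_ind: b => [ss|j b IH|c b b' IH IH'].
- by rewrite dd_sigs act0 fshift0 scaler0 addr0 act_sig.
- rewrite mulrA sigX -mulrA !act_X ddX (addrC (_ * dd _ _ b)) actL act_X.
  rewrite -/(strand i) fshiftD fshiftZ.
  have xh := rep_hlinX xs_rep (strand i j).
  rewrite (rep_SX xs_rep) -IH (hlinearD _ _ xh) (hlinearZ _ _ xh) (hlinear_shift _ xh).
  by rewrite scalerDr scalerA addrA addrAC.
- rewrite mulrDr -scalerAr linearP !actL fshiftD fshiftZ.
  have sh := rep_hlinS xs_rep i.
  rewrite (hlinearD _ _ sh) (hlinearZ _ _ sh) -IH -IH' !scalerDr !scalerA [a * c]mulrC.
  by rewrite addrACA.
Qed.

End Action.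
End Representations.

(** * The representation given by divided differences *)

Section Model.
Variables (F : fieldType) (k : nat) (A : nh_algebra F k) (a : F).
Local Notation cls := (@ncls F k A).
Local Notation "'x_ j" := (cls [:: X_ j]) (at level 8, j at level 2).
Local Notation "'s_ i" := (cls [:: sig_ i]) (at level 8, i at level 2).
Local Notation V := (nat -> A).
Local Notation ddi i := (dd (A := A) (lo i) (hi i)).
Implicit Types (j : 'I_k) (i : 'I_k.-1) (b : A) (f v : V).

Lemma mull_linear b : linear (fun y : A => b * y).
Proof. by move=> c y z; rewrite mulrDr -scalerAr. Qed.

Lemma dd_linear p q : linear (dd (A := A) p q).
Proof. exact: linearP. Qed.

Section Adjacent.
Variables (i i' : 'I_k.-1).
Hypothesis ii : i' = i.+1 :> nat.
Local Notation p := (lo i).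
Local Notation q := (hi i).
Local Notation r := (hi i').

Let qE : lo i' = q. Proof. exact: lo_next. Qed.
Let pq : p != q. Proof. exact: lo_neq_hi. Qed.
Let qr : q != r. Proof. by rewrite -qE lo_neq_hi. Qed.
Let rp : r != p. Proof. by rewrite -val_eqE /= ii; lia. Qed.
Let sp : strand i p = q. Proof. exact: tpermL. Qed.
Let sq : strand i q = p. Proof. exact: tpermR. Qed.
Let sr : strand i r = r. Proof. exact: strand_hi_next. Qed.
Let tp : strand i' p = p. Proof. exact: strand_lo_next. Qed.
Let tq : strand i' q = r. Proof. by rewrite -qE; exact: tpermL. Qed.
Let tr : strand i' r = q. Proof. by rewrite -qE; exact: tpermR. Qed.

(** The braid relation for sigma_i + a hbar D_(i, i+1) is compared by order in a hbar; this lemma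
    and the next two are orders one, two and three. Here the middle term on each side vanishes
    through sigma^2 = 0 and the outer ones are exchanged. *)
Lemma braid1 b :
  's_ i * ('s_ i' * ddi i b) + 's_ i * ddi i' ('s_ i * b) + ddi i ('s_ i' * ('s_ i * b)) =
  's_ i' * ('s_ i * ddi i' b) + 's_ i' * ddi i ('s_ i' * b) + ddi i' ('s_ i * ('s_ i' * b)).
Proof.
rewrite !(ddS, qE, sp, sq, sr, tp, tq, tr) !mulrA !sig_sig !mul0r !addr0.
by rewrite addrC.
Qed.

Let yb1 b : dd q r (dd p q b) = dd p q (dd p r b) + dd p r (dd q r b).
Proof.
have rq : r != q by rewrite eq_sym.
have qp : q != p by rewrite eq_sym.
have pr : p != r by rewrite eq_sym.
have := dd_yang_baxter b rq qp pr.
rewrite (dd_opp q r) (dd_opp p q b) linearN opprK (dd_opp p q) (dd_opp q r b) linearN.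
by move/eqP; rewrite -addrA -opprD subr_eq0 => /eqP.
Qed.

Let yb2 b : dd p q (dd q r b) = dd q r (dd p r b) + dd p r (dd p q b).
Proof.
have := dd_yang_baxter b pq qr rp.
rewrite (dd_opp p r b) linearN (dd_opp p r).
by move/eqP; rewrite -addrA -opprD subr_eq0 => /eqP.
Qed.

(** With the divided differences moved to the right, the Yang-Baxter relation splits the first term
    on each side; one half cancels against the last term because of the sign of exchanged
    indices. *)
Lemma braid2 b :
  's_ i * ddi i' (ddi i b) + ddi i ('s_ i' * ddi i b) + ddi i (ddi i' ('s_ i * b)) =
  's_ i' * ddi i (ddi i' b) + ddi i' ('s_ i * ddi i' b) + ddi i' (ddi i ('s_ i' * b)).
Proof.
rewrite !(ddS, qE, sp, sq, sr, tp, tq, tr).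
rewrite yb1 yb2 (dd_opp p q) (dd_opp q r) !mulrDr !mulrN.
have cancel (u v w : A) : u + v + w - u = v + w by rewrite -(addrA u) [LHS]addrC addKr.
by rewrite !cancel addrC.
Qed.

(** The classical braid relation of divided differences: by Yang-Baxter and D^2 = 0 both sides
    reduce to D_pq D_pr D_qr. *)
Lemma braid3 b : ddi i (ddi i' (ddi i b)) = ddi i' (ddi i (ddi i' b)).
Proof. by rewrite qE yb1 linearD /= dd_dd add0r yb1 dd_dd linear0 addr0. Qed.

End Adjacent.

(* Multiplication by [a] hbar. *)
Definition hbar f : V := a *: fshift f.

Lemma hbarD f g : hbar (f + g) = hbar f + hbar g.
Proof. by rewrite /hbar fshiftD scalerDr. Qed.

Lemma hlinear_hbar (T : V -> V) f : hlinear T -> T (hbar f) = hbar (T f).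
Proof. by move=> Th; rewrite /hbar (hlinearZ _ _ Th) (hlinear_shift _ Th). Qed.

Section Expand.
Variables (S0 E0 S1 E1 S2 E2 : V -> V).
Hypotheses (S0h : hlinear S0) (E0h : hlinear E0) (S1h : hlinear S1) (E1h : hlinear E1).

Lemma hbar_expand2 f :
  let g := S2 f + hbar (E2 f) in
  S1 g + hbar (E1 g) =
  S1 (S2 f) + hbar (S1 (E2 f) + E1 (S2 f)) + hbar (hbar (E1 (E2 f))).
Proof.
rewrite /= (hlinearD _ _ S1h) (hlinearD _ _ E1h).
rewrite (hlinear_hbar _ S1h) (hlinear_hbar _ E1h) !hbarD.
by rewrite !addrA.
Qed.

Lemma hbar_expand3 f :
  let g := S2 f + hbar (E2 f) in let g' := S1 g + hbar (E1 g) in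
  S0 g' + hbar (E0 g') =
  S0 (S1 (S2 f)) +
  hbar (S0 (S1 (E2 f)) + S0 (E1 (S2 f)) + E0 (S1 (S2 f))) +
  hbar (hbar (S0 (E1 (E2 f)) + E0 (S1 (E2 f)) + E0 (E1 (S2 f)))) +
  hbar (hbar (hbar (E0 (E1 (E2 f))))).
Proof.
move=> g g'; rewrite /g' hbar_expand2 !(hlinearD _ _ S0h) !(hlinearD _ _ E0h).
rewrite !(hlinear_hbar _ S0h) !(hlinear_hbar _ E0h) !(hlinearD _ _ S0h) !(hlinearD _ _ E0h).
rewrite !hbarD -!addrA; congr (_ + (_ + (_ + _))).
by rewrite addrCA.
Qed.

End Expand.

Definition model_X j f : V := fun n => 'x_ j * f n.
Definition model_S i f : V := (fun n => 's_ i * f n) + hbar (fun n => ddi i (f n)).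

Let mullh b := hlinear_pointwise (mull_linear b).
Let ddh p q := hlinear_pointwise (dd_linear p q).

Lemma hlinear_model_X j : hlinear (model_X j).
Proof. exact: mullh. Qed.

Lemma hlinear_model_S i : hlinear (model_S i).
Proof.
have := hlinear_comp (hlinear_fshift A) (ddh (lo i) (hi i)).
exact: hlinear_add (mullh _).
Qed.

Lemma model_rep : nh_rep a model_X model_S.
Proof.
pose S i f : V := fun n => 's_ i * f n.
pose E i f : V := fun n => ddi i (f n).
have Sh i : hlinear (S i) by exact: mullh.
have Eh i : hlinear (E i) by exact: ddh.
have mE i f : model_S i f = S i f + hbar (E i f) by [].
have hbar0 : hbar 0 = 0 by rewrite /hbar fshift0 scaler0.
split=> [j|i|j j' v|i v|i i' v ii|i i' v ii|i j v].
- exact: hlinear_model_X.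
- exact: hlinear_model_S.
- by apply/funext => n; rewrite /model_X !mulrA XX.
- rewrite !mE (hbar_expand2 _ _ (Sh i) (Eh i)) /S /E.
  have -> : (fun n => 's_ i * ('s_ i * v n)) = 0.
    by apply/funext => n; rewrite mulrA sig_sig mul0r.
  have -> : (fun n => ddi i (ddi i (v n))) = 0.
    by apply/funext => n; rewrite dd_dd.
  (* Moving D_(i, i+1) past sigma_i exchanges its two indices, hence changes its sign. *)
  have -> : (fun n => 's_ i * ddi i (v n)) + (fun n => ddi i ('s_ i * v n)) = 0.
    apply/funext => n; rewrite fctE ddS [strand i (lo i)]tpermL [strand i (hi i)]tpermR.
    by rewrite (dd_opp (lo i) (hi i)) mulrN subrr.
  by rewrite !hbar0 !addr0.
- have fixed : [/\ strand i (lo i') = lo i', strand i (hi i') = hi i',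
      strand i' (lo i) = lo i & strand i' (hi i) = hi i].
    by split; rewrite /strand tpermD // -val_eqE /=; lia.
  case: fixed => f1 f2 f3 f4.
  rewrite !mE (hbar_expand2 _ _ (Sh i) (Eh i)) (hbar_expand2 _ _ (Sh i') (Eh i')).
  congr (_ + hbar _ + hbar (hbar _)); apply/funext => n; rewrite /S /E.
  + by rewrite !mulrA sig_far.
  + by rewrite !fctE !ddS f1 f2 f3 f4 addrC.
  + by rewrite dd_disjoint // -val_eqE /=; lia.
- rewrite !mE (hbar_expand3 _ _ (Sh i) (Eh i) (Sh i') (Eh i')).
  rewrite (hbar_expand3 _ _ (Sh i') (Eh i') (Sh i) (Eh i)).
  congr (_ + hbar _ + hbar (hbar _) + hbar (hbar (hbar _))); apply/funext => n;
    rewrite /S /E.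
  + by rewrite !mulrA sig_braid.
  + exact: braid1.
  + exact: braid2.
  + exact: braid3.
- rewrite !mE (hlinearD _ _ (hlinear_model_X _)) (hlinear_hbar _ (hlinear_model_X _)).
  rewrite -addrA; congr (_ + _).
    by apply/funext => n; rewrite /model_X /S !mulrA sigX.
  (* What remains is the Leibniz rule, whose last term is the deformation constant. *)
  rewrite -scalerA -fshiftZ -scalerDr -fshiftD; congr hbar.
  by apply/funext => n; rewrite fctE /model_X /E ddX.
Qed.

Definition model_act b f : V := act model_X model_S b f.

Lemma model_act_const b b' : model_act b (fconst b') 0%N = b * b'.
Proof.
elim/sorted_ind: b => [ss|j b IH|c b1 b2 IH1 IH2]; last first.
- by rewrite /model_act (actL model_rep) !fctE -!/(model_act _ _) IH1 IH2 mulrDl -scalerAl.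
- by rewrite /model_act (act_X model_rep) /model_X -/(model_act _ _) IH mulrA.
elim: ss => [|i ss IH]; first by rewrite /= ncls_nil mul1r /model_act (act_nil model_rep).
rewrite /= cls_cons /model_act (act_sig model_rep) /model_S fctE -/(model_act _ _) IH.
by rewrite /hbar fctE /= scaler0 addr0 mulrA.
Qed.

(** On 1 no correction survives: sigma letters act first and their products have zero divided
    differences, then the X_j act undeformed. *)
Lemma model_act1 b : model_act b (fconst 1) = fconst b.
Proof.
elim/sorted_ind: b => [ss|j b IH|c b1 b2 IH1 IH2]; last first.
- by rewrite /model_act (actL model_rep) -!/(model_act _ _) IH1 IH2 fconstL.
- rewrite /model_act (act_X model_rep) -/(model_act _ _) IH.
  exact: pointwise_const (mull_linear _).
elim: ss => [|i ss IH]; first by rewrite /= ncls_nil /model_act (act_nil model_rep).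
rewrite /= cls_cons /model_act (act_sig model_rep) -/(model_act _ _) IH /model_S.
rewrite (pointwise_const _ (mull_linear _)) (pointwise_const _ (dd_linear _ _)).
rewrite dd_sigs; have -> : fconst (0 : A) = 0 by apply/funext => -[|n].
by rewrite /hbar fshift0 scaler0 addr0.
Qed.

Section Universal.
Variables (x : 'I_k -> V -> V) (s : 'I_k.-1 -> V -> V).
Hypothesis xs_rep : nh_rep a x s.

Definition series_act f v : V := fext (fun b => act x s b v) f.

Lemma hlinear_series_act v : hlinear (series_act^~ v).
Proof. exact: hlinear_fext (act_linear xs_rep v). Qed.

Lemma series_act_const b v : series_act (fconst b) v = act x s b v.
Proof. exact: fext_const (act_linear xs_rep v). Qed.

Lemma series_act_X j f v : series_act (model_X j f) v = x j (series_act f v).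
Proof.
apply: (hlinear_eq (T := fun f => series_act (model_X j f) v)
  (T' := fun f => x j (series_act f v))).
- exact: hlinear_comp (hlinear_series_act v) (hlinear_model_X j).
- exact: hlinear_comp (rep_hlinX xs_rep j) (hlinear_series_act v).
move=> b; rewrite /model_X (pointwise_const _ (mull_linear _)) !series_act_const.
exact: act_X xs_rep _ _ _.
Qed.

Lemma series_act_S i f v : series_act (model_S i f) v = s i (series_act f v).
Proof.
apply: (hlinear_eq (T := fun f => series_act (model_S i f) v)
  (T' := fun f => s i (series_act f v))).
- exact: hlinear_comp (hlinear_series_act v) (hlinear_model_S i).
- exact: hlinear_comp (rep_hlinS xs_rep i) (hlinear_series_act v).
move=> b; rewrite /model_S (pointwise_const _ (mull_linear _)).
rewrite (pointwise_const _ (dd_linear _ _)) (hlinearD _ _ (hlinear_series_act v)).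
rewrite (hlinear_hbar _ (hlinear_series_act v)) !series_act_const.
exact: act_S xs_rep _ _ _.
Qed.

(** Universality: f |-> f.v intertwines the model with any representation with the same constant
    [a]. Associativity of the model product and multiplicativity of the gauge map are instances. *)
Lemma series_act_model_act b f v : series_act (model_act b f) v = act x s b (series_act f v).
Proof.
elim/sorted_ind: b => [ss|j b IH|c b1 b2 IH1 IH2]; last first.
- rewrite /model_act (actL model_rep) -!/(model_act _ _).
  rewrite (hlinearD _ _ (hlinear_series_act v)) (hlinearZ _ _ (hlinear_series_act v)) IH1 IH2.
  by rewrite (actL xs_rep).
- by rewrite /model_act (act_X model_rep) series_act_X -/(model_act _ _) IH (act_X xs_rep).
elim: ss => [|i ss IH].
  by rewrite /= ncls_nil /model_act (act_nil model_rep) (act_nil xs_rep).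
rewrite /= cls_cons /model_act (act_sig model_rep) series_act_S -/(model_act _ _) IH.
by rewrite (act_sig xs_rep).
Qed.

End Universal.

End Model.

(** * Degrees *)

Section Degrees.
Variables (F : fieldType) (k : nat) (A : nh_algebra F k).
Local Notation cls := (@ncls F k A).
Local Notation "'x_ j" := (cls [:: X_ j]) (at level 8, j at level 2).
Local Notation "'s_ i" := (cls [:: sig_ i]) (at level 8, i at level 2).
Local Notation V := (nat -> A).
Implicit Types (j p q : 'I_k) (i : 'I_k.-1) (b : A) (f v : V) (w : word k) (d e : int * int).

Lemma word_deg_cons (l : letter k) w : word_deg (l :: w) = letter_deg l + word_deg w.
Proof. by rewrite /word_deg big_cons. Qed.

Lemma word_deg_cat (w w' : word k) : word_deg (w ++ w') = word_deg w + word_deg w'.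
Proof. by rewrite /word_deg big_cat. Qed.

(** With m letters X and n letters sigma the degree is (n - m, n). All rigidity arguments rest on
    these two inequalities. *)
Lemma word_deg_bounds w : 0 <= (word_deg w).2 /\ (word_deg w).1 <= (word_deg w).2.
Proof.
elim: w => [|[j|i] w [IH1 IH2]]; first by rewrite /word_deg big_nil.
  by rewrite word_deg_cons /=; split; lia.
by rewrite word_deg_cons /=; split; lia.
Qed.

Lemma word_deg_eq0 w : word_deg w = 0 -> w = [::].
Proof.
case: w => [|[j|i] w] //; have [b1 b2] := word_deg_bounds w;
  rewrite word_deg_cons => -[] /=; lia.
Qed.

Lemma nhomog_neg2 d b : nhomog d b -> d.2 < 0 -> b = 0.
Proof.
move=> hb d0; move: b hb; apply: nhomog_ind => // [w wd|c x y -> ->].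
  by have [+ _] := word_deg_bounds w; rewrite wd leNgt d0.
by rewrite scaler0 addr0.
Qed.

Lemma nhomog_neg1 d b : nhomog d b -> d.2 < d.1 -> b = 0.
Proof.
move=> hb d0; move: b hb; apply: nhomog_ind => // [w wd|c x y -> ->].
  by have [_ +] := word_deg_bounds w; rewrite wd leNgt d0.
by rewrite scaler0 addr0.
Qed.

Lemma nhomog_deg0 b : nhomog 0 b -> exists c, b = c *: 1.
Proof.
move: b; apply: nhomog_ind => [|w /word_deg_eq0 ->|c x y [d ->] [e ->]].
- by exists 0; rewrite scale0r.
- by exists 1; rewrite ncls_nil scale1r.
- by exists (c * d + e); rewrite scalerA scalerDl.
Qed.

Lemma nhomogD d x y : nhomog (n := A) d x -> nhomog d y -> nhomog d (x + y).
Proof. by rewrite -{2}[x]scale1r; exact: nhomogL. Qed.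

Lemma nhomogZ d c x : nhomog (n := A) d x -> nhomog d (c *: x).
Proof. by move=> hx; rewrite -[c *: x]addr0; apply: nhomogL hx (nhomog0 A d). Qed.

Lemma nhomogM d e x y : nhomog (n := A) d x -> nhomog e y -> nhomog (d + e) (x * y).
Proof.
move=> hx hy; move: x hx; apply: nhomog_ind => [|w wd|c x x' hx hx'].
- by rewrite mul0r; exact: nhomog0.
- move: y hy; apply: nhomog_ind => [|w' wd'|c y y' hy hy'].
  + by rewrite mulr0; exact: nhomog0.
  + by rewrite -ncls_cat -wd -wd' -word_deg_cat; exact: nhomog_cls.
  + by rewrite mulrDr -scalerAr; exact: nhomogL.
- by rewrite mulrDl -scalerAl; exact: nhomogL.
Qed.

Lemma nhomog_X j : nhomog (-1, 0) 'x_ j.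
Proof.
have := nhomog_cls A [:: X_ j].
by rewrite word_deg_cons /word_deg big_nil addr0.
Qed.

Lemma nhomog_S i : nhomog (1, 1) 's_ i.
Proof.
have := nhomog_cls A [:: sig_ i].
by rewrite word_deg_cons /word_deg big_nil addr0.
Qed.

Lemma nhomog1 : nhomog 0 (1 : A).
Proof. by have := nhomog_cls A [::]; rewrite /word_deg big_nil ncls_nil. Qed.

(** A divided difference removes one letter X, of degree (-1, 0). *)
Lemma nhomog_dd p q d b : nhomog d b -> nhomog (d + (1, 0)) (dd p q b).
Proof.
move: b; apply: nhomog_ind => [|w <-|c x y hx hy].
- by rewrite linear0; exact: nhomog0.
- rewrite dd_cls; elim: w p q => [|[j|i] w IH] p q /=; first exact: nhomog0.
    rewrite word_deg_cons -addrA; apply: nhomogD.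
      exact: nhomogM (nhomog_X _) (IH _ _).
    apply: nhomogZ; rewrite [word_deg w + _]addrC addrA.
    by have -> : letter_deg (k := k) (inl j) + (1, 0) = 0 by []; rewrite add0r; exact: nhomog_cls.
  by rewrite word_deg_cons -addrA; exact: nhomogM (nhomog_S _) (IH _ _).
- by rewrite linearP; exact: nhomogL.
Qed.

Definition fhomog d f : Prop := forall n : nat, nhomog (d.1, d.2 - n%:Z) (f n).

Lemma fhomog0 d : fhomog d 0.
Proof. by move=> n; exact: nhomog0. Qed.

Lemma fhomogD d f g : fhomog d f -> fhomog d g -> fhomog d (f + g).
Proof. by move=> hf hg n; exact: nhomogD (hf n) (hg n). Qed.

Lemma fhomogZ d c f : fhomog d f -> fhomog d (c *: f).
Proof. by move=> hf n; exact: nhomogZ (hf n). Qed.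

Lemma fhomog_const d b : nhomog d b -> fhomog d (fconst b).
Proof.
move=> hb [|n] /=; last exact: nhomog0.
by rewrite subr0 -surjective_pairing.
Qed.

Lemma fhomog_head d f : fhomog d f -> nhomog d (f 0%N).
Proof. by move=> /(_ 0%N); rewrite subr0 -surjective_pairing. Qed.

Lemma fhomog_shift d f : fhomog d f -> fhomog (d + (0, 1)) (fshift f).
Proof.
move=> hf [|n] /=; first exact: nhomog0.
have -> : (d.1 + 0, d.2 + 1 - n.+1%:Z) = (d.1, d.2 - n%:Z) by congr (_, _); lia.
exact: hf.
Qed.

Lemma fhomog_tail d f : fhomog d f -> fhomog (d - (0, 1)) (ftail f).
Proof.
move=> hf n /=; have := hf n.+1.
by have -> : (d.1, d.2 - n.+1%:Z) = (d.1 - 0, d.2 - 1 - n%:Z) by congr (_, _); lia.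
Qed.

Definition degree_shift (T : V -> V) e : Prop :=
  forall d f, fhomog d f -> fhomog (d + e) (T f).

Lemma fhomog_fext (G : A -> V) e d f :
  (forall d b, nhomog d b -> fhomog (d + e) (G b)) ->
  fhomog d f -> fhomog (d + e) (fext G f).
Proof.
move=> Gh hf n; elim: n d f hf => [|n IH] d f hf.
  by rewrite [fext G f 0]addr0; exact: (Gh _ _ (fhomog_head hf) 0%N).
apply: nhomogD; first exact: (Gh _ _ (fhomog_head hf) n.+1).
have := IH _ _ (fhomog_tail hf); rewrite /=.
by have -> : (d.1 - 0 + e.1, d.2 - 1 + e.2 - n%:Z) = (d.1 + e.1, d.2 + e.2 - n.+1%:Z)
  by congr (_, _); lia.
Qed.

Lemma degree_model_X j : degree_shift (model_X j) (-1, 0).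
Proof.
move=> d f hf n; have := nhomogM (nhomog_X j) (hf n).
by have -> : (-1, 0) + (d.1, d.2 - n%:Z) = ((d + (-1, 0)).1, (d + (-1, 0)).2 - n%:Z)
  by congr (_, _) => /=; lia.
Qed.

Lemma degree_model_S a i : degree_shift (model_S a i) (1, 1).
Proof.
move=> d f hf; apply: fhomogD.
  move=> n; have := nhomogM (nhomog_S i) (hf n).
  by have -> : (1, 1) + (d.1, d.2 - n%:Z) = ((d + (1, 1)).1, (d + (1, 1)).2 - n%:Z)
    by congr (_, _) => /=; lia.
apply: fhomogZ; have -> : d + (1, 1) = (d + (1, 0)) + (0, 1) by rewrite -addrA.
apply: fhomog_shift => n; have := nhomog_dd (lo i) (hi i) (hf n).
by have -> : (d.1, d.2 - n%:Z) + (1, 0) = ((d + (1, 0)).1, (d + (1, 0)).2 - n%:Z)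
    by congr (_, _) => /=; lia.
Qed.

Section ActDegree.
Variables (a : F) (x : 'I_k -> V -> V) (s : 'I_k.-1 -> V -> V).
Hypotheses (xs_rep : nh_rep a x s).
Hypotheses (xd : forall j, degree_shift (x j) (-1, 0)).
Hypotheses (sd : forall i, degree_shift (s i) (1, 1)).

Lemma fhomog_act d e b v : nhomog d b -> fhomog e v -> fhomog (d + e) (act x s b v).
Proof.
move=> + hv; move: b; apply: nhomog_ind => [|w <-|c b b' hb hb'].
- by rewrite (act0 xs_rep); exact: fhomog0.
- rewrite (act_cls xs_rep).
  (* The letters X and sigma act in two separate stages, so the degree of the word is split
     accordingly. *)
  have [dx [ds [-> hs hx]]] : exists dx ds, [/\ word_deg w = dx + ds,
      forall e v, fhomog e v -> fhomog (ds + e) (spart s w v) &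
      forall e h v, fhomog e v -> fhomog (dx + e) (xpart x w h v)].
    elim: w => [|[j|i] w [dx [ds [wE hs hx]]]].
    + by exists 0, 0; rewrite /word_deg big_nil; split=> [|e' v'|e' f' v']; rewrite ?add0r.
    + exists (dx + (-1, 0)), ds; split=> // [|e' f v' hv' /=].
        by rewrite word_deg_cons wE addrC -!addrA [ds + _]addrC.
      by rewrite -addrA [(-1, 0) + _]addrC addrA; apply/xd/hx.
    + exists dx, (ds + (1, 1)); split=> // [|e' v' hv' /=|e' f v' hv' /=].
      * by rewrite word_deg_cons wE addrC -!addrA.
      * by rewrite -addrA [(1, 1) + _]addrC addrA; apply/sd/hs.
      * exact: hx.
  by rewrite -addrA; apply/hx/hs.
- by rewrite (actL xs_rep); apply: fhomogD => //; exact: fhomogZ.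
Qed.

Lemma fhomog_series_act d e f v : fhomog d f -> fhomog e v -> fhomog (d + e) (series_act x s f v).
Proof.
by move=> hf hv; apply: fhomog_fext => // d' b hb; exact: fhomog_act.
Qed.

End ActDegree.

(** The indicator function of a word that occurs in no relation, inside any context, is
    rule-invariant; it descends and takes the value 1 on the class of that word. *)
Lemma invariant_delta w :
  (forall t u r r' : word k, word_rule r r' ->
    (t ++ r ++ u != w) && (t ++ r' ++ u != w)) ->
  (forall (t u : word k) i, t ++ [:: sig_ i; sig_ i] ++ u != w) -> cls w != 0.
Proof.
move=> h1 h2; pose g (u : word k) : A := (u == w)%:R.
have gi : rule_invariant g.
  split=> [t u r r' rr|t u i]; rewrite /g; last by rewrite (negPf (h2 t u i)).
  by have /andP[/negPf -> /negPf ->] := h1 t u r r' rr.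
apply/eqP => w0; have := nlift_cls gi w.
have -> : nlift g (cls w) = 0.
  rewrite w0; have := nlift_linear gi (-1) 0 0.
  by rewrite scaler0 addr0 scaleN1r addNr.
by rewrite /g eqxx => /esym/eqP; rewrite oner_eq0.
Qed.

Lemma sig_neq0 i : 's_ i != 0.
Proof.
have sz (u : word k) : (1 < size u)%N -> u != [:: sig_ i].
  by move=> u1; apply/eqP => uE; rewrite uE in u1.
apply: invariant_delta => [t u r r' rr|t u i'].
  by rewrite !sz // !size_cat; case: rr => * /=; lia.
by rewrite sz // !size_cat /=; lia.
Qed.

(** Relations of length two among sigma letters concern equal indices or indices at distance at
    least two. The result allows scalars to be compared in the braid relation of a deformation. *)
Lemma sig_next_neq0 i i' : i' = i.+1 :> nat -> 's_ i * 's_ i' != 0.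
Proof.
move=> ii; rewrite -ncls_cat.
pose idx (l : letter k) := if l is inr m then Some (val m) else None.
have key (t u r : word k) : (1 < size r)%N -> t ++ r ++ u = [:: sig_ i; sig_ i'] ->
    map idx r = [:: Some (val i); Some (val i')].
  move=> r2 e; have := congr1 size e; rewrite !size_cat /= => sz.
  have [t0 u0] : t = [::] /\ u = [::].
    by move: sz r2 {e}; case: t => [|? ?]; case: u => [|? ?] //= sz r2; lia.
  by move: e; rewrite t0 u0 cats0 /= => ->.
apply: invariant_delta => [t u r r' rr|t u i0].
  apply/andP; split; apply/eqP => /key.
    by case: rr => [m n|m n mn|m n mn|m n] /(_ isT) //= [] e1 e2; lia.
  by case: rr => [m n|m n mn|m n mn|m n] /(_ isT) //= [] e1 e2; lia.
by apply/eqP => e; have [] := key t u [:: sig_ i0; sig_ i0] isT e; lia.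
Qed.

End Degrees.

(** * Inverting maps that are the identity modulo hbar *)

Section Invertible.
Variables (F : fieldType) (V : lmodType F) (T : (nat -> V) -> (nat -> V)).
Hypotheses (Th : hlinear T) (T0 : forall f, T f 0%N = f 0%N).

Lemma hlinear_inj : injective T.
Proof.
suff ker f : T f = 0 -> f = 0.
  move=> f g Tfg; apply/eqP; rewrite -subr_eq0; apply/eqP/ker.
  by rewrite (hlinearD _ _ Th) -scaleN1r (hlinearZ _ _ Th) scaleN1r Tfg subrr.
move=> Tf; apply/funext => n; elim: n f Tf => [|n IH] f Tf.
  by rewrite -T0 Tf.
have f0 : f = fshift (ftail f).
  apply/funext => -[|m] //=; by rewrite -T0 Tf.
apply: (IH (ftail f)); apply/funext => m.
have := congr1 (fun g => g m.+1) Tf.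
by rewrite {1}f0 (hlinear_shift _ Th).
Qed.

(** Successive approximation: g - T (g 0) has no constant term, so its quotient by hbar can be
    inverted recursively. *)
Fixpoint hlinv (g : nat -> V) n : V :=
  if n is m.+1 then hlinv (ftail (g - T (fconst (g 0%N)))) m else g 0%N.

Lemma hlinvE g : hlinv g = fconst (g 0%N) + fshift (hlinv (ftail (g - T (fconst (g 0%N))))).
Proof. by apply/funext => -[|n]; rewrite fctE /= ?addr0 ?add0r. Qed.

Lemma hlinvK : cancel hlinv T.
Proof.
move=> g; apply/funext => n; elim: n g => [|n IH] g; first by rewrite T0.
rewrite hlinvE (hlinearD _ _ Th) (hlinear_shift _ Th) fctE.
rewrite -[fshift _ _]/(T (hlinv _) n) IH.
exact: etrans (addrC _ _) (subrK _ _).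
Qed.

End Invertible.

(** * Graded deformations *)

Section Deformation.
Variables (F : fieldType) (k : nat) (A : nh_algebra F k).
Local Notation cls := (@ncls F k A).
Local Notation "'x_ j" := (cls [:: X_ j]) (at level 8, j at level 2).
Local Notation "'s_ i" := (cls [:: sig_ i]) (at level 8, i at level 2).
Local Notation V := (nat -> A).
Implicit Types (j p q : 'I_k) (i : 'I_k.-1) (b : A) (f g v : V) (w : word k) (d e : int * int).

(** This and the following definitions repeat those for [NH] over an abstract [nh_algebra], in a
    form that agrees with them by conversion for [NH_str]. *)
Definition gscale (c : nat -> F) f : V := fun n => \sum_(i < n.+1) c i *: f (n - i)%N.

Lemma gscaleE c f : gscale c f = c 0%N *: f + fshift (gscale (fun n => c n.+1) f).
Proof.
apply/funext => -[|n]; rewrite fctE /= /gscale; first by rewrite big_ord1 addr0.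
by rewrite big_ord_recl subn0.
Qed.

Lemma hlinear_gscale (T : V -> V) c f : hlinear T -> T (gscale c f) = gscale c (T f).
Proof.
move=> Th; apply/funext => n; elim: n c => [|n IH] c;
  rewrite (gscaleE c f) (hlinearD _ _ Th) (hlinearZ _ _ Th) (hlinear_shift _ Th).
  by rewrite (gscaleE c (T f)).
by rewrite (gscaleE c (T f)) !fctE; congr (_ + _); exact: IH.
Qed.

Definition gdeformed (nu : A -> A -> V) b b' : V :=
  fun n => (if n == 0%N then b * b' else 0) + nu b b' n.

Definition gstar (nu : A -> A -> V) f g : V :=
  fun n => \sum_(i < n.+1) \sum_(j < (n - i).+1) gdeformed nu (f i) (g j) (n - i - j)%N.

Record gMC (nu : A -> A -> V) : Prop := GMC {
  gMC_linearl : forall b n, linear (fun b' => nu b' b n);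
  gMC_linearr : forall b n, linear (fun b' => nu b b' n);
  gMC_hbar : forall b b', nu b b' 0%N = 0;
  gMC_assoc : forall f g h, gstar nu f (gstar nu g h) = gstar nu (gstar nu f g) h;
  gMC_homog : forall d e b b', nhomog d b -> nhomog e b' -> fhomog (d + e) (nu b b')
}.

Section Bilinear.
Variable nu : A -> A -> V.
Hypothesis nul : forall b n, linear (fun b' => nu b' b n).
Hypothesis nur : forall b n, linear (fun b' => nu b b' n).

Lemma gdeformed_linearl b n : linear (fun b' => gdeformed nu b' b n).
Proof.
move=> c b1 b2; rewrite /gdeformed nul scalerDr addrACA; congr (_ + _).
by case: eqP; rewrite ?scaler0 ?addr0 // mulrDl -scalerAl.
Qed.

Lemma gdeformed_linearr b n : linear (fun b' => gdeformed nu b b' n).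
Proof.
move=> c b1 b2; rewrite /gdeformed nur scalerDr addrACA; congr (_ + _).
by case: eqP; rewrite ?scaler0 ?addr0 // mulrDr -scalerAr.
Qed.

Lemma gdeformed0l b n : gdeformed nu 0 b n = 0.
Proof.
by have := gdeformed_linearl b n (-1) 0 0; rewrite scaler0 addr0 scaleN1r addNr.
Qed.

Lemma gdeformed0r b n : gdeformed nu b 0 n = 0.
Proof.
by have := gdeformed_linearr b n (-1) 0 0; rewrite scaler0 addr0 scaleN1r addNr.
Qed.

Lemma hlinear_gstarl g : hlinear (gstar nu ^~ g).
Proof.
split=> [c f f'|f]; apply/funext => n.
  transitivity (c *: gstar nu f g n + gstar nu f' g n); last by [].
  rewrite /gstar scaler_sumr -big_split /=; apply: eq_bigr => i _.
  rewrite scaler_sumr -big_split /=; apply: eq_bigr => j _.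
  exact: gdeformed_linearl.
rewrite /gstar; case: n => [|n]; first by rewrite !big_ord1 gdeformed0l.
rewrite big_ord_recl big1 ?add0r => [|j _]; last exact: gdeformed0l.
by [].
Qed.

Lemma hlinear_gstarr f : hlinear (gstar nu f).
Proof.
split=> [c g g'|g]; apply/funext => n.
  transitivity (c *: gstar nu f g n + gstar nu f g' n); last by [].
  rewrite /gstar scaler_sumr -big_split /=; apply: eq_bigr => i _.
  rewrite scaler_sumr -big_split /=; apply: eq_bigr => j _.
  exact: gdeformed_linearr.
rewrite /gstar; case: n => [|n]; first by rewrite !big_ord1 gdeformed0r.
rewrite big_ord_recr /= subnn big_ord1 gdeformed0r addr0; apply: eq_bigr => i _.
by rewrite subSn -1?ltnS // big_ord_recl gdeformed0r add0r.
Qed.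

Lemma gstar_const b b' : gstar nu (fconst b) (fconst b') = gdeformed nu b b'.
Proof.
apply/funext => n; rewrite /gstar big_ord_recl [X in _ + X]big1 => [|i _]; last first.
  by rewrite big1 // => j _; exact: gdeformed0l.
rewrite addr0 big_ord_recl [X in _ + X]big1 => [|j _]; last exact: gdeformed0r.
by rewrite addr0 !subn0.
Qed.

End Bilinear.

Section MaurerCartan.
Variable nu : A -> A -> V.
Hypothesis nuMC : gMC nu.
Local Infix "⋆" := (gstar nu) (at level 40).

Let nul := gMC_linearl nuMC.
Let nur := gMC_linearr nuMC.
Let nuA := gMC_assoc nuMC.
Let lh g : hlinear (fun f => f ⋆ g) := hlinear_gstarl nul g.
Let rh f : hlinear (gstar nu f) := hlinear_gstarr nur f.

Lemma gstar_head f g : (f ⋆ g) 0%N = f 0%N * g 0%N.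
Proof. by rewrite /gstar !big_ord1 /gdeformed eqxx (gMC_hbar nuMC) addr0. Qed.

Lemma fhomog_gstar d e f g : fhomog d f -> fhomog e g -> fhomog (d + e) (f ⋆ g).
Proof.
move=> hf hg n; rewrite /gstar.
elim/big_ind: _ => [|y z|i _]; [exact: nhomog0 | exact: nhomogD |].
elim/big_ind: _ => [|y z|j _]; [exact: nhomog0 | exact: nhomogD |].
have hm : fhomog ((d.1, d.2 - i%:Z) + (e.1, e.2 - j%:Z)) (gdeformed nu (f i) (g j)).
  move=> m; apply: nhomogD; last exact: (gMC_homog nuMC (hf i) (hg j)).
  case: eqP => [->|_]; last exact: nhomog0.
  by rewrite subr0; exact: nhomogM (hf i) (hg j).
have := hm (n - i - j)%N.
have ij : (n - i - j)%:Z = n%:Z - i%:Z - j%:Z.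
  by have := ltn_ord i; have := ltn_ord j; lia.
have -> : (((d.1, d.2 - i%:Z) + (e.1, e.2 - j%:Z)).1,
   ((d.1, d.2 - i%:Z) + (e.1, e.2 - j%:Z)).2 - (n - i - j)%:Z) =
   ((d + e).1, (d + e).2 - n%:Z) by congr (_, _); rewrite ij /=; lia.
by [].
Qed.

(** The bounds on degrees leave no room for positive powers of hbar. The condition holds in the
    degrees of X_j X_j', of products of sigma letters and of 1, but fails at (0, 1), the degree of
    sigma_i X_j; that is where a deformation can occur. *)
Lemma fhomog_eq0 d f : fhomog d f -> f 0%N = 0 ->
  (d.2 - 1 < d.1) || (d.2 - 1 < 0) -> f = 0.
Proof.
move=> hf f0 /orP dd; apply/funext => -[|n] //.
case: dd => dd; first by apply: (nhomog_neg1 (hf n.+1)) => /=; lia.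
by apply: (nhomog_neg2 (hf n.+1)) => /=; lia.
Qed.

Lemma fhomog_scalar f : fhomog 0 f -> exists c, f = c *: fconst 1.
Proof.
move=> hf; have [c fc] := nhomog_deg0 (fhomog_head hf).
exists c; apply/funext => -[|n] //.
by rewrite fctE /= scaler0; apply: (nhomog_neg2 (hf n.+1)) => /=; lia.
Qed.

(** By degree 1 is idempotent for the deformed product; multiplication by it is injective, being the
    identity modulo hbar, so associativity makes it a left unit. *)
Lemma gstar1 f : fconst 1 ⋆ f = f.
Proof.
have h1 : fhomog 0 (fconst (1 : A)) by exact: fhomog_const (nhomog1 A).
have e11 : fconst 1 ⋆ fconst 1 = fconst 1.
  have := fhomog_gstar h1 h1; rewrite addr0 => h11.
  have := fhomogD h11 (fhomogZ (-1) h1); rewrite scaleN1r => /fhomog_eq0.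
  rewrite fctE gstar_head /= mulr1 subrr => /(_ erefl isT)/eqP.
  by rewrite subr_eq0 => /eqP.
apply: (hlinear_inj (rh (fconst 1))) => [g|]; first by rewrite gstar_head mul1r.
by rewrite nuA e11.
Qed.

Lemma hX j : fhomog (-1, 0) (fconst 'x_ j).
Proof. exact/fhomog_const/nhomog_X. Qed.

Lemma hS i : fhomog (1, 1) (fconst 's_ i).
Proof. exact/fhomog_const/nhomog_S. Qed.

Lemma fhomog_gstar_eq d f g : fhomog d f -> fhomog d g -> f 0%N = g 0%N ->
  (d.2 - 1 < d.1) || (d.2 - 1 < 0) -> f = g.
Proof.
move=> hf hg fg dd; apply/eqP; rewrite -subr_eq0 -scaleN1r; apply/eqP.
apply: (fhomog_eq0 (d := d)) dd; first exact: fhomogD hf (fhomogZ _ hg).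
by rewrite fctE fctE scaleN1r fg subrr.
Qed.

Definition star_X j f := fconst 'x_ j ⋆ f.
Definition star_S i f := fconst 's_ i ⋆ f.

Lemma star_XX j j' f : star_X j (star_X j' f) = star_X j' (star_X j f).
Proof.
rewrite /star_X !nuA; congr (_ ⋆ _).
apply: (fhomog_gstar_eq (fhomog_gstar (hX j) (hX j')) (fhomog_gstar (hX j') (hX j))) => //.
by rewrite !gstar_head XX.
Qed.

Lemma star_SS i f : star_S i (star_S i f) = 0.
Proof.
rewrite /star_S nuA -[RHS](hlinear0 (lh f)); congr (_ ⋆ _).
apply: (fhomog_eq0 (fhomog_gstar (hS i) (hS i))) => //.
by rewrite gstar_head sig_sig.
Qed.

Lemma star_far i i' f : (i' + 2 <= i)%N -> star_S i (star_S i' f) = star_S i' (star_S i f).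
Proof.
move=> ii; rewrite /star_S !nuA; congr (_ ⋆ _).
apply: (fhomog_gstar_eq (fhomog_gstar (hS i) (hS i')) (fhomog_gstar (hS i') (hS i))) => //.
by rewrite !gstar_head sig_far.
Qed.

Lemma star_braid i i' f : i' = i.+1 :> nat ->
  star_S i (star_S i' (star_S i f)) = star_S i' (star_S i (star_S i' f)).
Proof.
move=> ii; rewrite /star_S !nuA; congr (_ ⋆ _).
have hSS l m := fhomog_gstar (hS l) (hS m).
apply: (fhomog_gstar_eq (fhomog_gstar (hSS i i') (hS i)) (fhomog_gstar (hSS i' i) (hS i'))) => //.
by rewrite !gstar_head sig_braid.
Qed.

(** The defect of the relation has degree (0, 1) and no constant term, so its quotient by hbar has
    degree 0 and is a scalar. *)
Lemma star_SX_scalar : exists e : 'I_k.-1 -> 'I_k -> F, forall i j f,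
  star_S i (star_X j f) = star_X (strand i j) (star_S i f) + e i j *: fshift f.
Proof.
have ex (ij : 'I_k.-1 * 'I_k) : exists c, fconst 's_ (ij.1) ⋆ fconst 'x_ (ij.2) =
    fconst 'x_ (strand ij.1 ij.2) ⋆ fconst 's_ (ij.1) + c *: fshift (fconst 1).
  case: ij => i j /=.
  pose h := fconst 's_ i ⋆ fconst 'x_ j - fconst 'x_ (strand i j) ⋆ fconst 's_ i.
  have hh : fhomog (0, 1) h.
    rewrite /h -scaleN1r; apply: fhomogD; first exact: fhomog_gstar (hS i) (hX j).
    by apply: fhomogZ; exact: fhomog_gstar (hX _) (hS i).
  have [c hc] := fhomog_scalar (fhomog_tail hh).
  exists c; rewrite -fshiftZ -hc; apply/eqP; rewrite addrC -subr_eq; apply/eqP.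
  rewrite -/h [LHS]fps_split -[RHS]add0r; congr (_ + _); apply/funext => -[|n] //.
  by rewrite /h /= !fctE !gstar_head /= sigX subrr.
have [e he] := choice ex.
exists (fun i j => e (i, j)) => i j f.
rewrite /star_S /star_X nuA (he (i, j)) /= (hlinearD _ _ (lh f)) (hlinearZ _ _ (lh f)).
by rewrite (hlinear_shift _ (lh f)) gstar1 nuA.
Qed.

Hypothesis two_neq0 : 2%:R != 0 :> F.

Lemma fshift_eq0 c f : f 0%N != 0 -> c *: fshift f = 0 -> c = 0.
Proof.
move=> f0 /(congr1 (fun g => g 1%N)); rewrite fctE /= => /eqP.
by rewrite scaler_eq0 (negPf f0) orbF => /eqP.
Qed.

(** Each constraint on the constants comes from applying a relation between sigma letters to X_j and
    comparing scalars; [fshift_eq0] cancels the remaining product of sigma letters, nonzero modulo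
    hbar. *)
Lemma star_rep : exists a, nh_rep a star_X star_S.
Proof.
have [e he] := star_SX_scalar.
have Sh i : hlinear (star_S i) by exact: rh.
have Xh j : hlinear (star_X j) by exact: rh.
have S0 i f : star_S i f 0%N = 's_ i * f 0%N by rewrite /star_S gstar_head.
(* From sigma_i^2 X_j = 0. *)
have anti i j : e i (strand i j) = - e i j.
  apply/eqP; rewrite -addr_eq0; apply/eqP.
  apply: (@fshift_eq0 _ (star_S i (fconst 1))); first by rewrite S0 mulr1 sig_neq0.
  rewrite scalerDl.
  have := star_SS i (star_X j (fconst 1)).
  rewrite he (hlinearD _ _ (Sh i)) he star_SS (hlinear0 (Xh _)) add0r.
  by rewrite (hlinearZ _ _ (Sh i)) (hlinear_shift _ (Sh i)).
have far i j : j != lo i -> j != hi i -> e i j = 0.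
  move=> jl jh; have := anti i j.
  have -> : strand i j = j by rewrite /strand tpermD // eq_sym.
  move/eqP; rewrite -addr_eq0 -mulr2n -mulr_natr mulf_eq0 (negPf two_neq0) orbF.
  by move/eqP.
(* Both sides of the braid relation are pushed past X_(lo i). After the terms with a repeated sigma
   vanish, each side carries one multiple of hbar sigma_i sigma_i', with constants e i (lo i) and e
   i' (lo i'). *)
have step i i' : i' = i.+1 :> nat -> e i (lo i) = e i' (lo i').
  move=> ii; have qE := lo_next ii.
  have sp : strand i (lo i) = hi i by exact: tpermL.
  have tq : strand i' (hi i) = hi i' by rewrite -qE; exact: tpermL.
  have := star_braid (star_X (lo i) (fconst 1)) ii.
  rewrite he sp (hlinearD _ _ (Sh i')) he tq (hlinearD _ _ (Sh i)).
  rewrite (hlinearD _ _ (Sh i)) he strand_hi_next //.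
  rewrite (far i (hi i')) ?scale0r ?addr0; last 2 first.
  - by rewrite -val_eqE /= ii; lia.
  - by rewrite -val_eqE /= ii; lia.
  rewrite (hlinearZ _ _ (Sh i)) (hlinear_shift _ (Sh i)) star_SS fshift0 scaler0 addr0.
  rewrite (hlinearZ _ _ (Sh i')) (hlinearZ _ _ (Sh i)).
  rewrite (hlinear_shift _ (Sh i')) (hlinear_shift _ (Sh i)).
  rewrite (he i' (lo i)) strand_lo_next // (far i' (lo i)) ?scale0r ?addr0; last 2 first.
  - by rewrite -val_eqE /= ii; lia.
  - by rewrite -val_eqE /= ii; lia.
  rewrite he sp (hlinearD _ _ (Sh i')) he tq.
  rewrite (hlinearZ _ _ (Sh i')) (hlinear_shift _ (Sh i')) star_SS fshift0 scaler0 addr0.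
  rewrite -(star_braid _ ii) => /addrI/eqP; rewrite -subr_eq0 -scalerBl => /eqP.
  move/fshift_eq0; rewrite !S0 mulr1 sig_next_neq0 // qE => /(_ isT)/eqP.
  by rewrite subr_eq0 => /eqP.
have [a ha] : exists a, forall i, e i (lo i) = a.
  (* Without sigma letters the scalar is unconstrained, and 0 is chosen. *)
  case: (posnP k.-1) => [k0|k0].
    by exists 0 => -[m mk]; exfalso; rewrite k0 in mk.
  exists (e (Ordinal k0) (lo (Ordinal k0))) => -[m mk].
  elim: m mk => [|m IH] mk; first by congr (e _ (lo _)); apply/val_inj.
  by rewrite -(IH (ltnW mk)); apply/esym/step.
exists a; split=> //; [exact: star_XX | exact: star_SS | exact: star_far | exact: star_braid |].
move=> i j v; rewrite he; congr (_ + _ *: _).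
rewrite /root_coef; have [->|jl] := eqVneq j (lo i).
  by rewrite ha (negPf (lo_neq_hi i)) subr0 mulr1.
have [->|jh] := eqVneq j (hi i); last by rewrite far // subrr mulr0.
rewrite -[hi i in LHS](tpermL (lo i)) -/(strand i) anti ha.
by rewrite sub0r mulrN1.
Qed.

End MaurerCartan.

End Deformation.

(** * The model product and its comparison with an arbitrary deformation *)

Section Classification.
Variables (F : fieldType) (k : nat) (A : nh_algebra F k).
Local Notation cls := (@ncls F k A).
Local Notation "'x_ j" := (cls [:: X_ j]) (at level 8, j at level 2).
Local Notation "'s_ i" := (cls [:: sig_ i]) (at level 8, i at level 2).
Local Notation V := (nat -> A).
Implicit Types (j p q : 'I_k) (i : 'I_k.-1) (b : A) (f g v : V) (w : word k) (d e : int * int).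

Definition ggauge (nu nu' : A -> A -> V) : Prop :=
  exists T : V -> V,
    [/\ bijective T,
        forall (c : nat -> F) f g, T (gscale c f \+ g) = gscale c (T f) \+ T g,
        forall f, T f 0%N = f 0%N,
        forall f g, T (gstar nu f g) = gstar nu' (T f) (T g)
      & forall d f, fhomog d f -> fhomog d (T f)].

(** Only the positive powers of hbar are kept, since [gdeformed] adds the undeformed product
    back. *)
Definition model_nu (a : F) b b' : V :=
  fun n => if n == 0%N then 0 else model_act a b (fconst b') n.

Section Model.
Variable a : F.

Lemma gdeformed_model b b' : gdeformed (model_nu a) b b' = model_act a b (fconst b').
Proof.
apply/funext => -[|n]; rewrite /gdeformed /model_nu /= ?add0r //.
by rewrite addr0 model_act_const.
Qed.

Lemma model_act_linearr b n : linear (fun b' => model_act a b (fconst b') n).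
Proof.
have mh := hlinear_act (model_rep A a) b.
move=> c b1 b2; rewrite /model_act fconstL (hlinearD _ _ mh) (hlinearZ _ _ mh).
by [].
Qed.

Lemma model_nu_linearl b n : linear (fun b' => model_nu a b' b n).
Proof.
move=> c b1 b2; rewrite /model_nu; case: eqP => _; first by rewrite scaler0 addr0.
by rewrite /model_act (actL (model_rep A a)).
Qed.

Lemma model_nu_linearr b n : linear (fun b' => model_nu a b b' n).
Proof.
move=> c b1 b2; rewrite /model_nu; case: eqP => _; first by rewrite scaler0 addr0.
exact: model_act_linearr.
Qed.

Lemma gstar_model b g : gstar (model_nu a) (fconst b) g = model_act a b g.
Proof.
move: g; apply: hlinear_eq; first exact: hlinear_gstarr model_nu_linearr _.
  exact: hlinear_act (model_rep A a) b.
by move=> b'; rewrite (gstar_const model_nu_linearl model_nu_linearr) gdeformed_model.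
Qed.

Lemma gstar_model_series_act f g :
  gstar (model_nu a) f g = series_act (@model_X _ _ A) (model_S a) f g.
Proof.
move: f; apply: (hlinear_eq (T := gstar (model_nu a) ^~ g)).
- exact: hlinear_gstarl model_nu_linearl g.
- exact: hlinear_series_act (model_rep A a) g.
by move=> b; rewrite gstar_model (series_act_const (model_rep A a)).
Qed.

Lemma model_nu_MC : gMC (model_nu a).
Proof.
split=> [b n|b n|b b'|f g h|d e b b' hb hb'].
- exact: model_nu_linearl.
- exact: model_nu_linearr.
- by rewrite /model_nu eqxx.
- have lh := hlinear_gstarl model_nu_linearl.
  move: f; apply: (hlinear_eq (T := gstar (model_nu a) ^~ (gstar (model_nu a) g h))
     (T' := fun f => gstar (model_nu a) (gstar (model_nu a) f g) h)) => [||b].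
  + exact: lh.
  + exact: hlinear_comp (lh h) (lh g).
  (* Associativity is universality of the model applied to the model itself. *)
  rewrite !gstar_model [RHS]gstar_model_series_act (series_act_model_act (model_rep A a)).
  by rewrite -gstar_model_series_act.
- move=> n; rewrite /model_nu; case: eqP => _; first exact: nhomog0.
  apply: (fhomog_act (model_rep A a)) => //; last exact: fhomog_const.
    exact: degree_model_X.
  exact: degree_model_S.
Qed.

(** The relation from which [a] is recovered; the first series on the right is a hbar. *)
Lemma model_SX i : gstar (model_nu a) (fconst 's_ i) (fconst 'x_ (lo i)) =
  gscale (fun n => if n == 1%N then a else 0) (fconst 1) \+
  gstar (model_nu a) (fconst 'x_ (hi i)) (fconst 's_ i).
Proof.
rewrite !gstar_model /model_act -['x_ (hi i)]mulr1 (act_X (model_rep A a)).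
have := act_sig (model_rep A a) i [::] (fconst 'x_ (lo i)).
rewrite /= ncls_nil mulr1 !(act_nil (model_rep A a)) => ->.
have -> : gscale (fun n => if n == 1%N then a else 0) (fconst 1) = hbar a (fconst (1 : A)).
  apply/funext => -[|n]; rewrite /gscale /hbar fctE /=; first by rewrite big_ord1 scale0r scaler0.
  rewrite big_ord_recl scale0r add0r big_ord_recl [X in _ + X]big1 ?addr0 => [|m _].
    by rewrite /= subn1.
  by rewrite scale0r.
rewrite -[RHS]/(hbar a (fconst 1) + model_X (hi i) (fconst 's_ i)) [RHS]addrC /model_S.
congr (_ + _).
  by rewrite (pointwise_const _ (mull_linear _)) /model_X (pointwise_const _ (mull_linear _)) sigX
    [strand i (lo i)]tpermL.
rewrite (pointwise_const _ (dd_linear _ _)); congr (hbar _ (fconst _)).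
rewrite -['x_ (lo i)]mulr1 ddX dd1 mulr0 add0r /root_coef eqxx (negPf (lo_neq_hi i)).
by rewrite subr0 scale1r.
Qed.

End Model.

Lemma model_nu_inj a a' i : ggauge (model_nu a) (model_nu a') -> a = a'.
Proof.
case=> T [_ Tl T0 TM Td].
have fix_ d b : nhomog d b -> (d.2 - 1 < d.1) || (d.2 - 1 < 0) -> T (fconst b) = fconst b.
  move=> hb dd; apply: (fhomog_gstar_eq _ _ _ dd); last exact: T0.
    exact/Td/fhomog_const.
  exact: fhomog_const.
have := congr1 T (model_SX a i); rewrite Tl !TM.
rewrite (fix_ _ _ (nhomog1 A)) // !(fix_ _ _ (nhomog_X A _)) // (fix_ _ _ (nhomog_S A i)) //.
rewrite model_SX => /(congr1 (fun g => g 1%N)) /= /addIr.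
rewrite /gscale !big_ord_recl !big_ord0 /= !scale0r !add0r !addr0 => /eqP.
rewrite -subr_eq0 -scalerBl scaler_eq0 oner_eq0 orbF subr_eq0.
by move/eqP.
Qed.

Section Gauge.
Variables (nu : A -> A -> V) (nuMC : gMC nu) (a : F).
Hypothesis nu_rep : nh_rep a (star_X nu) (star_S nu).

Definition gauge_map f : V := series_act (star_X nu) (star_S nu) f (fconst 1).

Lemma hlinear_gauge_map : hlinear gauge_map.
Proof. exact: hlinear_series_act nu_rep _. Qed.

Lemma gauge_map_const b : gauge_map (fconst b) = act (star_X nu) (star_S nu) b (fconst 1).
Proof. exact: series_act_const nu_rep _ _. Qed.

(** By associativity of the deformation, acting by [b] is left multiplication by the image of 1
    under [b]. *)
Lemma act_star b v : act (star_X nu) (star_S nu) b v =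
  gstar nu (act (star_X nu) (star_S nu) b (fconst 1)) v.
Proof.
have lh := hlinear_gstarl (gMC_linearl nuMC) v.
elim/sorted_ind: b => [ss|j b IH|c b1 b2 IH1 IH2]; last first.
- by rewrite !(actL nu_rep) IH1 IH2 (hlinearD _ _ lh) (hlinearZ _ _ lh).
- by rewrite !(act_X nu_rep) IH /star_X (gMC_assoc nuMC).
elim: ss => [|i ss IH]; first by rewrite /= ncls_nil !(act_nil nu_rep) (gstar1 nuMC).
by rewrite /= cls_cons !(act_sig nu_rep) IH /star_S (gMC_assoc nuMC).
Qed.

(** For constant [f], universality turns the model product into the action on [gauge_map g], which
    [act_star] identifies with the deformed product. *)
Lemma gauge_map_star f g :
  gauge_map (gstar (model_nu a) f g) = gstar nu (gauge_map f) (gauge_map g).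
Proof.
have gh := hlinear_gauge_map.
have lh g' := hlinear_gstarl (gMC_linearl nuMC) g'.
move: f; apply: (hlinear_eq (T := fun f => gauge_map (gstar (model_nu a) f g))
   (T' := fun f => gstar nu (gauge_map f) (gauge_map g))) => [||b].
- exact: hlinear_comp gh (hlinear_gstarl (model_nu_linearl a) g).
- exact: hlinear_comp (lh _) gh.
by rewrite gstar_model gauge_map_const -act_star /gauge_map (series_act_model_act nu_rep).
Qed.

Lemma gauge_map_head f : gauge_map f 0%N = f 0%N.
Proof.
rewrite /gauge_map /series_act /= addr0; move: (f 0%N) => {f}.
elim/sorted_ind => [ss|j b IH|c b1 b2 IH1 IH2]; last first.
- by rewrite (actL nu_rep) !fctE IH1 IH2.
- by rewrite (act_X nu_rep) /star_X (gstar_head nuMC) IH.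
elim: ss => [|i ss IH]; first by rewrite /= ncls_nil (act_nil nu_rep).
by rewrite /= cls_cons (act_sig nu_rep) /star_S (gstar_head nuMC) IH.
Qed.

Lemma fhomog_gauge_map d f : fhomog d f -> fhomog d (gauge_map f).
Proof.
move=> hf; rewrite -[d]addr0; apply: (fhomog_series_act nu_rep) => // [j|i|].
- by move=> e g hg; rewrite addrC; apply: (fhomog_gstar nuMC) => //; exact: hX.
- by move=> e g hg; rewrite addrC; apply: (fhomog_gstar nuMC) => //; exact: hS.
exact: fhomog_const (nhomog1 A).
Qed.

Lemma gauge_model : ggauge nu (model_nu a).
Proof.
have gh := hlinear_gauge_map; have g0 := gauge_map_head.
have gK := hlinvK gh g0; have gI := hlinear_inj gh g0.
(* [gauge_map] leads from the model to [nu], so its inverse is the required equivalence. *)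
exists (hlinv gauge_map); split=> [|c f g|f|f g|d f hf].
- by exists gauge_map => // f; apply: gI; rewrite gK.
- apply: gI; rewrite gK.
  apply: etrans _ (esym (hlinearD _ _ gh)).
  by rewrite (hlinear_gscale _ _ gh) !gK.
- by [].
- by apply: gI; rewrite gK gauge_map_star !gK.
(* The inverse preserves degrees by its own recursion: division of the remainder by hbar lowers the
   degree by (0, 1). *)
move=> n; elim: n d f hf => [|n IH] d f hf; first exact: (hf 0%N).
have hf0 := fhomog_gauge_map (fhomog_const (fhomog_head hf)).
have := fhomogD hf (fhomogZ (-1) hf0); rewrite scaleN1r => /fhomog_tail/IH /=.
by have -> : (d.1 - 0, d.2 - 1 - n%:Z) = (d.1, d.2 - n.+1%:Z) by congr (_, _); lia.
Qed.

End Gauge.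

End Classification.

(** * Termination of the reductions *)

Section Reductions.
Variables (K : comNzRingType) (k : nat) (c : K).
Implicit Types (p q : free K k) (u v w s t : word k).

Let rhoK (i : 'I_k.-1) (j : 'I_k) : K := (j == lo i)%:R - (j == hi i)%:R.

Variant context_rule (s : word k) (u v : word k) (Phi : free K k) : Prop :=
| ContextSX i j : s = [:: sig_ i; X_ j] ->
    Phi = mono K (u ++ [:: X_ (strand i j); sig_ i] ++ v) + (c * rhoK i j) *: mono K (u ++ v) ->
    context_rule s u v Phi
| ContextWord t : word_rule s t -> (forall i j, s <> [:: sig_ i; X_ j]) ->
    Phi = mono K (u ++ t ++ v) -> context_rule s u v Phi
| ContextSS i : s = [:: sig_ i; sig_ i] -> Phi = 0 -> context_rule s u v Phi.

Fact mulr_sandwichD (T : pzRingType) (x y z t : T) : x * (y + z) * t = x * y * t + x * z * t.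
Proof. by rewrite mulrDr mulrDl. Qed.

Lemma rule_context s phi u v : rule c s phi ->
  context_rule s u v (mono K u * phi * mono K v).
Proof.
move=> r.
have [[t [i [j [-> -> ->]]]]|[[t [r' ns ->]]|[i -> ->]]] := rule_word_rule r.
- apply: (@ContextSX _ u v _ i j) => //.
  apply: etrans (mulr_sandwichD _ _ _ _) _.
  apply: etrans (congr1 (+%R^~ _) (mono3 _ _ _ _)) _; congr (_ + _).
  apply: etrans (congr1 (fun x => x * mono K v) (malg_scaleAr _ _ _)) _.
  apply: etrans (malg_scaleAl _ _ _) _; congr (_ *: _).
  by apply: etrans (congr1 (fun x => x * mono K v) (mulr1 _)) _; exact: monoM.
- by apply: (@ContextWord _ u v _ t) => //; exact: mono3.
- apply: (@ContextSS _ u v _ i) => //.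
  by apply: etrans (congr1 (fun x => x * mono K v) (mulr0 _)) _; exact: mul0r.
Qed.

Section Invariance.
Variables (V : nmodType) (h : K -> word k -> V).
Hypotheses (h0 : forall w, h 0 w = 0) (hD : forall a b w, h (a + b) w = h a w + h b w).
Hypothesis h_SX : forall e u v i j, h e (u ++ [:: sig_ i; X_ j] ++ v) =
  h e (u ++ [:: X_ (strand i j); sig_ i] ++ v) + h (e * (c * rhoK i j)) (u ++ v).
Hypothesis h_word : forall e u v s t, word_rule s t -> (forall i j, s <> [:: sig_ i; X_ j]) ->
  h e (u ++ s ++ v) = h e (u ++ t ++ v).
Hypothesis h_SS : forall e u v i, h e (u ++ [:: sig_ i; sig_ i] ++ v) = 0.

(** A reduction adds a multiple of the difference of the two sides of a rule in context, and the
    hypotheses on [h] say that its value vanishes. *)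
Lemma reduction_ext p q : reduction c p q -> malg_ext h p = malg_ext h q.
Proof.
case=> u s v phi {}p r; set e := p@_ _; set w := u ++ s ++ v in e *.
have eD := malg_extD h0 hD; have eZ := malg_extZmono h0.
rewrite eD -[LHS]addr0; congr (_ + _); apply/esym.
have cancel x : x = h e w -> x + h (- e) w = 0.
  by move=> ->; rewrite -hD subrr h0.
have step Phi x : malg_ext h (e *: Phi) = x -> x = h e w ->
    malg_ext h (e *: (Phi - mono K w)) = 0.
  move=> Phix xh; rewrite -(cancel _ xh) -Phix -eZ -eD; congr malg_ext.
  by rewrite scalerBr scaleNr.
case: (rule_context u v r) => [i j sE ->|t r' ns ->|i sE ->].
- apply: (step _ (h e (u ++ [:: X_ (strand i j); sig_ i] ++ v) +
                   h (e * (c * rhoK i j)) (u ++ v))); last by rewrite /w sE h_SX.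
  apply: etrans (congr1 (malg_ext h) (scalerDr e _ _)) _.
  apply: etrans (eD _ _) _; rewrite eZ; congr (_ + _).
  exact: etrans (congr1 (malg_ext h) (scalerA _ _ _)) (eZ _ _).
- by apply: step; [exact: eZ | rewrite /w (h_word _ _ _ r')].
- apply: (step _ 0); first by rewrite scaler0 malg_ext0.
  by rewrite /w sE h_SS.
Qed.

Lemma reduces_ext p q : reduces c p q -> malg_ext h p = malg_ext h q.
Proof. by elim=> // {}q r _ -> /reduction_ext. Qed.

End Invariance.

Section Measure.
Variable L : nat.

(* On words of length at most [L], replacing a letter by one of the same kind changes
   its pair weights with the other letters by at most [L] in total; the weight [L.+1]
   of a pair sigma X, and of a unit of index of sigma, compensates for this. *)
Definition pair_weight (l l' : letter k) : nat :=
  match l, l' with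
  | inr i, inl j => L.+1
  | inl i, inl j => (j < i)%N
  | inr i, inr j => (j + 2 <= i)%N
  | inl _, inr _ => 0
  end.

(** Decreasing in the index, because the braid rule replaces one sigma_i by sigma_(i+1). *)
Definition letter_weight (l : letter k) : nat := if l is inr i then ((k - i) * L.+1)%N else 0.

Definition cross (l : letter k) w : nat := \sum_(l' <- w) pair_weight l l'.
Definition cross' w (l : letter k) : nat := \sum_(l' <- w) pair_weight l' l.

Fixpoint weight w : nat :=
  if w is l :: w' then (letter_weight l + cross l w' + weight w')%N else 0%N.

Lemma cross_cat l w w' : cross l (w ++ w') = (cross l w + cross l w')%N.
Proof. by rewrite /cross big_cat. Qed.

Lemma cross_cons l l' w : cross l (l' :: w) = (pair_weight l l' + cross l w)%N.
Proof. by rewrite /cross big_cons. Qed.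

Lemma weight_cat u w : weight (u ++ w) =
  (weight u + weight w + \sum_(l <- u) cross l w)%N.
Proof.
elim: u => [|l u IH]; first by rewrite big_nil addn0.
rewrite cat_cons -[weight (l :: u ++ w)]/(letter_weight l + cross l (u ++ w) + weight (u ++ w))%N.
by rewrite IH cross_cat big_cons -[weight (l :: u)]/(letter_weight l + cross l u + weight u)%N; lia.
Qed.

Lemma sum_cross u s w : (\sum_(l <- u) cross l (s ++ w) =
  \sum_(l <- s) cross' u l + \sum_(l <- u) cross l w)%N.
Proof.
have -> : (\sum_(l <- s) cross' u l = \sum_(l <- u) cross l s)%N.
  by rewrite /cross' /cross exchange_big.
by rewrite -big_split /=; apply: eq_bigr => l _; rewrite cross_cat.
Qed.

Lemma cross'_cons l l' w : cross' (l' :: w) l = (pair_weight l' l + cross' w l)%N.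
Proof. by rewrite /cross' big_cons. Qed.

Fact size_cons_word (l : letter k) w : size (l :: w) = (size w).+1.
Proof. by []. Qed.

Lemma cross_X_le i j w : (cross (X_ i) w <= cross (X_ j) w + size w)%N.
Proof.
elim: w => [|l w IH]; first by rewrite /cross big_nil.
rewrite !cross_cons size_cons_word.
have : (pair_weight (X_ i) l <= pair_weight (X_ j) l + 1)%N.
  by case: l => l //=; case: (l < i)%N; case: (l < j)%N.
by move: (pair_weight _ _) (pair_weight _ _) => a b; lia.
Qed.

Lemma cross_S_le i j w : (cross (sig_ i) w <= cross (sig_ j) w + size w)%N.
Proof.
elim: w => [|l w IH]; first by rewrite /cross big_nil.
rewrite !cross_cons size_cons_word.
have : (pair_weight (sig_ i) l <= pair_weight (sig_ j) l + 1)%N.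
  by case: l => l /=; [exact: leq_addr | case: (l + 2 <= i)%N; case: (l + 2 <= j)%N].
by move: (pair_weight _ _) (pair_weight _ _) => a b; lia.
Qed.

Lemma cross'_X_le i j w : (cross' w (X_ i) <= cross' w (X_ j) + size w)%N.
Proof.
elim: w => [|l w IH]; first by rewrite /cross' big_nil.
rewrite !cross'_cons size_cons_word.
have : (pair_weight l (X_ i) <= pair_weight l (X_ j) + 1)%N.
  by case: l => l /=; [case: (i < l)%N; case: (j < l)%N | exact: leq_addr].
by move: (pair_weight _ _) (pair_weight _ _) => a b; lia.
Qed.

Lemma cross'_S_le i j w : (cross' w (sig_ i) <= cross' w (sig_ j) + size w)%N.
Proof.
elim: w => [|l w IH]; first by rewrite /cross' big_nil.
rewrite !cross'_cons size_cons_word.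
have : (pair_weight l (sig_ i) <= pair_weight l (sig_ j) + 1)%N.
  by case: l => l //=; case: (i + 2 <= l)%N; case: (j + 2 <= l)%N.
by move: (pair_weight _ _) (pair_weight _ _) => a b; lia.
Qed.

Lemma weight_context u s v : weight (u ++ s ++ v) =
  (weight u + weight v + \sum_(l <- u) cross l v +
   (weight s + \sum_(l <- s) cross l v + \sum_(l <- s) cross' u l))%N.
Proof. by rewrite !weight_cat sum_cross; lia. Qed.

Fact weight_cons l w : weight (l :: w) = (letter_weight l + cross l w + weight w)%N.
Proof. by []. Qed.

Lemma weight2 l l' : weight [:: l; l'] = (letter_weight l + letter_weight l' + pair_weight l l')%N.
Proof. by rewrite !weight_cons cross_cons /cross !big_nil /weight; lia. Qed.

Lemma weight3 l l' l'' : weight [:: l; l'; l''] =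
  (letter_weight l + letter_weight l' + letter_weight l'' +
   (pair_weight l l' + pair_weight l l'' + pair_weight l' l''))%N.
Proof. by rewrite weight_cons weight2 !cross_cons /cross !big_nil; lia. Qed.

Lemma pair_weight_sig (i i' : 'I_k.-1) : (i < i' + 2)%N -> pair_weight (sig_ i) (sig_ i') = 0%N.
Proof. by move=> ii; rewrite /pair_weight /= leqNgt ii. Qed.

Lemma letter_weight_next (i i' : 'I_k.-1) : i' = i.+1 :> nat ->
  letter_weight (sig_ i) = (letter_weight (sig_ i') + L.+1)%N.
Proof.
move=> ii; rewrite /letter_weight /= ii addnC -mulSn; congr (_ * _)%N.
by have := ltn_ord i; lia.
Qed.

(** For sigma_i X_j and for the braid rule the gain of L + 1 exceeds the change of at most L caused
    in the context by one altered index. The other two rules only permute letters, so the context is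
    unaffected and one inversion disappears. *)
Lemma weight_rule s t u v : word_rule s t -> (forall j j', s = [:: X_ j; X_ j'] -> (j' < j)%N) ->
  (size u + size v <= L)%N -> (weight (u ++ t ++ v) < weight (u ++ s ++ v))%N.
Proof.
move=> r XXlt uvL; rewrite !weight_context ltn_add2l.
case: r XXlt => [i j|i i' ii|i i' ii|j j'] XXlt;
  rewrite !big_cons !big_nil !addn0 ?weight2 ?weight3.
- have h1 := cross_X_le (strand i j) j v; have h2 := cross'_X_le (strand i j) j u.
  rewrite -[pair_weight (sig_ i) (X_ j)]/L.+1 -[pair_weight (X_ _) (sig_ i)]/0%N.
  rewrite -[letter_weight (X_ _)]/0%N -[letter_weight (X_ j)]/0%N.
  by move: (letter_weight _) => W; lia.
- have h1 := cross_S_le i' i v; have h2 := cross'_S_le i' i u.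
  rewrite !pair_weight_sig ?addn0; try by lia.
  rewrite (letter_weight_next ii).
  by move: (letter_weight _) => W; lia.
- have -> : pair_weight (sig_ i) (sig_ i') = 1%N by rewrite /pair_weight /= ii.
  rewrite pair_weight_sig; last by lia.
  by move: (letter_weight _) (letter_weight _) => W W'; lia.
- have jj := XXlt _ _ erefl.
  have -> : pair_weight (X_ j) (X_ j') = 1%N by rewrite /pair_weight /= jj.
  have -> : pair_weight (X_ j') (X_ j) = 0%N by rewrite /pair_weight /= ltnNge (ltnW jj).
  by move: (letter_weight _) (letter_weight _) => W W'; lia.
Qed.

Lemma weight_SX_drop i j u v :
  (weight (u ++ v) < weight (u ++ [:: sig_ i; X_ j] ++ v))%N.
Proof.
rewrite weight_context weight2 -[pair_weight (sig_ i) (X_ j)]/L.+1 weight_cat.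
by rewrite -[ltnLHS]addn0 ltn_add2l addnS.
Qed.

End Measure.

End Reductions.

(** * Existence of normal forms *)

Section Normalization.
Variables (K : comNzRingType) (k : nat) (c : K).
Implicit Types (p q : free K k) (u v w s t : word k) (m : {fmonom (letter k)}).

Lemma rule_XX_lt j j' (phi : free K k) : rule c [:: X_ j; X_ j'] phi -> (j' < j)%N.
Proof.
move=> r; have [s sE] : exists s, s = [:: X_ j; X_ j'] by eexists.
rewrite -sE in r; case: r sE => // i i' ii [e1 e2].
by rewrite -e1 -e2.
Qed.

Lemma context_supp L s (phi : free K k) u v m : rule c s phi ->
  (size (u ++ s ++ v) <= L)%N -> (mono K u * phi * mono K v)@_m != 0 ->
  (weight L m < weight L (u ++ s ++ v))%N /\ (size m <= L)%N.
Proof.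
move=> r sz; have XXlt : forall j j', s = [:: X_ j; X_ j'] -> (j' < j)%N.
  by move=> j j' sE; rewrite sE in r; exact: rule_XX_lt r.
have wt t : word_rule s t -> (0 < size s)%N ->
    (weight L (u ++ t ++ v) < weight L (u ++ s ++ v))%N /\ (size (u ++ t ++ v) <= L)%N.
  move=> rt s0; split.
    by apply: weight_rule => //; move: sz; rewrite !size_cat; lia.
  by move: sz; rewrite !size_cat; case: rt {XXlt r s0} => *.
case: (rule_context u v r) => [i j sE ->|t rt _ ->|i sE ->].
- rewrite mcoeffD mcoeffZ !mcoeff_mono.
  have [<- _|_] := eqVneq (u ++ [:: X_ (strand i j); sig_ i] ++ v) m.
    by apply: wt; rewrite sE //; exact: WordSX.
  have [<- _|_] := eqVneq (u ++ v) m; last by rewrite mulr0 addr0 eqxx.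
  rewrite sE; split; first exact: weight_SX_drop.
  by move: sz; rewrite sE !size_cat /=; lia.
- rewrite mcoeff_mono.
  have [<- _|_] := eqVneq (u ++ t ++ v) m; last by rewrite eqxx.
  by apply: wt => //; case: rt {XXlt r sz}.
- by rewrite mcoeff0 eqxx.
Qed.

Definition reduct p u s v (phi : free K k) : free K k :=
  p + p@_(FMonom (u ++ s ++ v)) *: (mono K u * phi * mono K v - mono K (u ++ s ++ v)).

(** The result of a rule involves only words of smaller weight, so the reduced word itself leaves
    the support for good. *)
Lemma reduct_supp L p u s v (phi : free K k) m : rule c s phi ->
  (size (u ++ s ++ v) <= L)%N -> m \in msupp (reduct p u s v phi) ->
  ((m : word k) != u ++ s ++ v /\ m \in msupp p) \/
  ((weight L m < weight L (u ++ s ++ v))%N /\ (size m <= L)%N).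
Proof.
move=> r sz; rewrite -!mcoeff_neq0 /reduct mcoeffD mcoeffZ mcoeffB mcoeff_mono.
have := context_supp (m := m) r sz.
set x := (_ * _)@_m; have [-> _|x0 /(_ isT) + _] := eqVneq x 0; last by right.
rewrite sub0r mulrN; have [e|ne] := eqVneq (u ++ s ++ v) m.
  have -> : FMonom (u ++ s ++ v) = m by rewrite e; apply/eqP; rewrite fmP.
  by rewrite mulr1 subrr eqxx.
by rewrite mulr0 subr0 => pm; left; split=> //; rewrite eq_sym.
Qed.

Definition reducible w : Prop :=
  exists u s v (phi : free K k), rule c s phi /\ w = u ++ s ++ v.

Lemma reduces_head p q r : reduction c p q -> reduces c q r -> reduces c p r.
Proof.
move=> pq; elim=> [|r' r'' _ IH r'r'']; first exact: ReducesStep (ReducesRefl c p) pq.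
exact: ReducesStep IH r'r''.
Qed.

Lemma normalize_bounded L N p :
  (forall m, m \in msupp p -> (size m <= L)%N /\ (reducible m -> (weight L m < N)%N)) ->
  exists2 q, reduces c p q & forall m, m \in msupp q -> ~ reducible m.
Proof.
elim: N p => [|N IHN] p hp.
  by exists p => [|m mp rm]; [exact: ReducesRefl | have [_ /(_ rm)] := hp m mp].
suff key (ws : seq (word k)) p' :
    (forall m, m \in msupp p' -> (size m <= L)%N /\ (reducible m ->
       (weight L m < N)%N \/ (weight L m < N.+1)%N /\ (m : word k) \in ws)) ->
    exists2 q, reduces c p' q & forall m, m \in msupp q -> ~ reducible m.
  apply: (key [seq (m : word k) | m <- msupp p]) => m mp.
  have [sz wt] := hp m mp; split=> // rm; right; split; first exact: wt.
  by apply/mapP; exists m.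
elim: ws p' => [|w ws IH] p' hp'.
  apply: IHN => m mp; have [sz wt] := hp' m mp; split=> // /wt [] // [_].
  by rewrite in_nil.
have [[wp rw]|nw] := pselect (FMonom w \in msupp p' /\ reducible w); last first.
  apply: IH => m mp; have [sz wt] := hp' m mp; split=> // rm.
  have [|[wm]] := wt rm; first by left.
  rewrite inE => /orP[/eqP mw|]; last by right.
  exfalso; apply: nw; rewrite -mw; split=> //.
  by have -> : FMonom m = m by apply/eqP; rewrite fmP.
have [szw wtw] := hp' _ wp.
have {}wtw : (weight L w < N.+1)%N by case: (wtw rw) => [/ltnW|[]].
have [u [s [v [phi [r wE]]]]] := rw.
have [q p'q qi] : exists2 q, reduces c (reduct p' u s v phi) q &
    forall m, m \in msupp q -> ~ reducible m.
  rewrite wE in szw wtw; apply: IH => m mp.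
  have [[mw mp']|[wt sz]] := reduct_supp r szw mp; last first.
    by split=> // _; left; exact: leq_trans wt wtw.
  have [sz wt] := hp' m mp'; split=> // /wt [|[wm]]; first by left.
  by rewrite inE wE (negPf mw) /=; right.
by exists q => //; apply: reduces_head p'q; exact: Reduction.
Qed.

Lemma normalize p : exists2 q, reduces c p q & forall m, m \in msupp q -> ~ reducible m.
Proof.
(* Sums over the support serve as bounds for each of its words. *)
pose L := (\sum_(m <- msupp p) size m)%N.
pose N := (\sum_(m <- msupp p) weight L m).+1.
apply: (normalize_bounded (L := L) (N := N)) => m mp.
split=> [|_]; first by rewrite /L (big_rem m) //= leq_addr.
by rewrite /N ltnS (big_rem m) //= leq_addr.
Qed.

End Normalization.

(** The left-hand sides of the rules depend neither on the constant nor on the coefficient ring. *)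
Lemma reducible_irreducible (F : fieldType) (K : comNzRingType) (k : nat) (c : K) (w : word k) :
  ~ reducible c w -> irreducible F w.
Proof.
move=> nw u s v phi r wE; apply: nw.
have [phi' r'] : exists phi', rule c s phi'.
  by case: r => *; eexists; econstructor; eauto.
by exists u, s, v, phi'.
Qed.

Lemma irreducible_sorted (F : fieldType) (k : nat) (w : word k) : irreducible F w ->
  exists xs ss, w = map (@X_ k) xs ++ map (@sig_ k) ss.
Proof.
elim: w => [|l w IH] irr; first by exists [::], [::].
have [xs [ss wE]] : exists xs ss, w = map (@X_ k) xs ++ map (@sig_ k) ss.
  by apply: IH => u s v phi r wE; apply: (irr (l :: u) s v phi r); rewrite wE.
case: l irr => [j|i] irr; first by exists (j :: xs), ss; rewrite wE.
case: xs wE => [|j xs] wE; first by exists [::], (i :: ss); rewrite wE.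
have [phi r] : exists phi : free F k, rule 0 [:: sig_ i; X_ j] phi.
  have [->|jl] := eqVneq j (lo i); first by eexists; exact: (RuleSXl 0 (b := hi i)).
  have [->|jh] := eqVneq j (hi i); first by eexists; exact: (RuleSXr 0 (a := lo i)).
  eexists; apply: RuleSXfar => e; [move: jl | move: jh];
    by rewrite -val_eqE /= e eqxx.
by case: (irr [::] _ (map (@X_ k) xs ++ map (@sig_ k) ss) phi r); rewrite wE.
Qed.

(** * Reductions compute the model product *)

Section Arising.
Variables (F : fieldType) (k : nat) (A : nh_algebra F k).
Local Notation cls := (@ncls F k A).
Local Notation V := (nat -> A).
Local Notation rho := (root_coef F).
Implicit Types (j : 'I_k) (i : 'I_k.-1) (b : A) (f g v : V) (w : word k).

Definition gproject (p : free {poly F} k) : V :=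
  fun n => \sum_(w <- msupp p) (p@_w)`_n *: cls w.

Definition garises (a : F) (nu : A -> A -> V) : Prop :=
  gMC nu /\
  forall (u v : word k) (p : free {poly F} k),
    irreducible F u -> irreducible F v ->
    reduces (a *: 'X) (mono {poly F} (u ++ v)) p ->
    (forall m, m \in msupp p -> irreducible F m) ->
    gdeformed nu (cls u) (cls v) = gproject p.

Lemma hlinear_gscaler (c : nat -> F) : hlinear (@gscale F k A c).
Proof.
split=> [d f g|f]; last by rewrite -(hlinear_gscale c f (hlinear_fshift A)).
apply/funext => n; rewrite !fctE /gscale scaler_sumr -big_split /=.
by apply: eq_bigr => m _; rewrite scalerDr !scalerA [d * _]mulrC.
Qed.

Lemma gscale_mulX (c : {poly F}) d f :
  gscale (fun n => (c * (d *: 'X))`_n) f = d *: fshift (gscale (fun n => c`_n) f).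
Proof.
rewrite gscaleE -scalerAr coefZ coefMX mulr0 scale0r add0r -fshiftZ; congr fshift.
apply/funext => n; rewrite fctE /gscale scaler_sumr; apply: eq_bigr => m _.
by rewrite coefZ coefMX scalerA.
Qed.

Lemma gscale_const (c : nat -> F) b n : gscale c (fconst b) n = c n *: b.
Proof.
rewrite /gscale big_ord_recr /= subnn big1 ?add0r // => m _.
by case: (n - m)%N (subn_gt0 m n) => [|l]; rewrite ?ltn_ord ?scaler0.
Qed.

Section Model.
Variable a : F.

Definition letter_op (l : letter k) : V -> V :=
  match l with inl j => model_X j | inr i => model_S a i end.

(** Letters act in the order in which they stand, without sorting as in [act], so the deformed rules
    hold exactly for these operators. On sorted words the two actions agree. *)
Definition word_op w v : V := foldr letter_op v w.

Lemma word_op_cat w w' v : word_op (w ++ w') v = word_op w (word_op w' v).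
Proof. exact: foldr_cat. Qed.

Lemma hlinear_word_op w : hlinear (word_op w).
Proof.
elim: w => [|[j|i] w IH]; first exact: (hlinear_id A).
  exact: (hlinear_comp (hlinear_model_X A j) IH).
exact: (hlinear_comp (hlinear_model_S A a i) IH).
Qed.

Lemma word_op_sorted xs ss v : let w := map (@X_ k) xs ++ map (@sig_ k) ss in
  word_op w v = model_act a (cls w) v.
Proof.
have mr := model_rep A a; rewrite /=; elim: xs => [|j xs IH] /=.
  elim: ss => [|i ss IH] /=; first by rewrite ncls_nil /model_act (act_nil mr).
  by rewrite cls_cons /model_act (act_sig mr) IH.
by rewrite cls_cons /model_act (act_X mr) IH.
Qed.

Lemma word_op1 w : irreducible F w -> word_op w (fconst 1) = fconst (cls w).
Proof.
move=> irr; have [xs [ss ->]] := irreducible_sorted irr.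
by rewrite word_op_sorted model_act1.
Qed.

Definition poly_ev (c : {poly F}) w : V := gscale (fun n => c`_n) (word_op w (fconst 1)).

Lemma poly_ev_reduces (p q : free {poly F} k) : reduces (a *: 'X) p q ->
  malg_ext poly_ev p = malg_ext poly_ev q.
Proof.
have mr := model_rep A a.
apply: reduces_ext => [w|c c' w|c u v i j|c u v s t r ns|c u v i].
- apply/funext => n; rewrite /poly_ev /gscale big1 // => m _.
  by rewrite coef0 scale0r.
- apply/funext => n; rewrite /poly_ev /gscale fctE -big_split /=.
  by apply: eq_bigr => m _; rewrite coefD scalerDl.
- rewrite /poly_ev !word_op_cat /= (rep_SX mr) (hlinearD _ _ (hlinear_word_op u)).
  rewrite (hlinearZ _ _ (hlinear_word_op u)) (hlinear_shift _ (hlinear_word_op u)).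
  rewrite (hlinearD _ _ (hlinear_gscaler _)) (hlinearZ _ _ (hlinear_gscaler _)).
  rewrite (hlinear_shift _ (hlinear_gscaler _)); congr (_ + _).
  rewrite -gscale_mulX; congr (gscale _ _); apply/funext => n; congr (c * _)`_n.
  have -> : (j == lo i)%:R - (j == hi i)%:R = (rho (lo i) (hi i) j)%:P :> {poly F}.
    by rewrite /root_coef rmorphB /= !rmorph_nat.
  by rewrite [RHS]mulrC mul_polyC scalerA mulrC.
- rewrite /poly_ev !word_op_cat; congr (gscale _ (word_op u _)).
  case: r ns => [i j|i i' ii|i i' ii|j j'] ns /=.
  + by case: (ns i j).
  + exact: (rep_braid mr).
  + exact: (rep_far mr).
  + exact: (rep_XX mr).
- rewrite /poly_ev !word_op_cat /= (rep_SS mr) (hlinear0 (hlinear_word_op u)).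
  exact: hlinear0 (hlinear_gscaler _).
Qed.

(** Whatever path the reduction takes, the value at 1 is preserved: it is the model product at the
    start, and the projection at the end because irreducible words are sorted. *)
Lemma model_arises : garises a (model_nu a).
Proof.
split=> [|u v p uirr virr red pirr]; first exact: model_nu_MC.
have h0 w : poly_ev 0 w = 0.
  apply/funext => n; rewrite /poly_ev /gscale big1 // => m _.
  by rewrite coef0 scale0r.
have := poly_ev_reduces red; rewrite malg_ext_mono //.
have -> : poly_ev 1 (u ++ v) = gdeformed (model_nu a) (cls u) (cls v).
  rewrite gdeformed_model /poly_ev word_op_cat word_op1 //.
  have [xs [ss ->]] := irreducible_sorted uirr.
  rewrite word_op_sorted; apply/funext => n.
  rewrite /gscale big_ord_recl coef1 scale1r subn0 big1 ?addr0 // => m _.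
  by rewrite coef1 scale0r.
move=> ->; apply/funext => n; rewrite /malg_ext /gproject fct_sumE.
by apply: eq_big_seq => w wp; rewrite /poly_ev word_op1 ?gscale_const //; exact: pirr.
Qed.

(** Irreducible words span: normalizing a word with constant 0 does not change its class. *)
Lemma linear_irreducible_eq (W : lmodType F) (f g : A -> W) : linear f -> linear g ->
  (forall w, irreducible F w -> f (cls w) = g (cls w)) -> f =1 g.
Proof.
move=> fl gl fg; apply: linear_cls_eq => // w.
have fD (h : A -> W) : linear h -> h 0 = 0 /\ forall c x y, h (c *: x + y) = c *: h x + h y.
  by move=> hl; split=> //; have := hl (-1) 0 0; rewrite scaler0 addr0 scaleN1r addNr.
have [f0 fL] := fD f fl; have [g0 gL] := fD g gl.
pose h (c : F) w : A := c *: cls w.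
have [q wq qirr] := normalize (0 : F) (mono F w).
have -> : cls w = malg_ext h q.
  rewrite -(reduces_ext (h := h) _ _ _ _ _ wq) => [|w'|c c' w'|c u v i j|c u v s t r _|c u v i].
  - by rewrite malg_ext_mono /h ?scale1r // => w'; rewrite scale0r.
  - exact: scale0r.
  - exact: scalerDl.
  - rewrite mul0r mulr0 /h scale0r addr0; congr (_ *: _).
    by rewrite !ncls_cat (ncls_rule A (WordSX i j)).
  - by rewrite /h !ncls_cat (ncls_rule A r).
  - by rewrite /h !ncls_cat ncls_sq mul0r mulr0 scaler0.
rewrite /malg_ext big_seq; apply: (big_rec (fun x => f x = g x)) => [|m x mq IH].
  by rewrite f0 g0.
by rewrite /h fL gL IH fg //; apply: reducible_irreducible (qirr m mq).
Qed.

(** Every concatenation of irreducible words has a normal form, so the defining condition fixes the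
    product on a spanning set of pairs. *)
Lemma arises_unique nu : garises a nu -> nu = model_nu a.
Proof.
move=> [nuMC nua]; have [mMC ma] := model_arises.
suff e b b' n : gdeformed nu b b' n = gdeformed (model_nu a) b b' n.
  apply/funext => b; apply/funext => b'; apply/funext => n.
  exact: addrI (e b b' n).
move: b; apply: linear_irreducible_eq.
- exact: (gdeformed_linearl (gMC_linearl nuMC)).
- exact: (gdeformed_linearl (gMC_linearl mMC)).
move=> u uirr; move: b'; apply: linear_irreducible_eq.
- exact: (gdeformed_linearr (gMC_linearr nuMC)).
- exact: (gdeformed_linearr (gMC_linearr mMC)).
move=> v virr; have [q uvq qirr] := normalize (a *: 'X) (mono {poly F} (u ++ v)).
have {}qirr m : m \in msupp q -> irreducible F m.
  by move/qirr; exact: reducible_irreducible.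
by rewrite (nua u v q) // (ma u v q).
Qed.

End Model.

Theorem nh_deformations (two_neq0 : 2%:R != 0 :> F) :
  [/\ forall a, exists! nu, garises a nu,
      forall nu, gMC nu -> exists a nu_a, garises a nu_a /\ ggauge nu nu_a
    & (1 < k)%N -> forall a a' nu_a nu_a', a <> a' -> garises a nu_a -> garises a' nu_a' ->
        ~ ggauge nu_a nu_a'].
Proof.
split=> [a|nu nuMC|k1 a a' nu nu' aa' /arises_unique -> /arises_unique ->].
- exists (model_nu a); split; first exact: model_arises.
  by move=> nu /arises_unique ->.
- have [a nu_rep] := star_rep nuMC two_neq0.
  exists a, (model_nu a); split; first exact: model_arises.
  exact: gauge_model.
(* The scalar is read off from a sigma letter, so one has to exist. *)
- have k0 : (0 < k.-1)%N by lia.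
  by move/(model_nu_inj (Ordinal k0)).
Qed.

End Arising.

(** * Transfer to the quotient algebra *)

Section Instance.
Variables (F : fieldType) (k : nat).
Local Notation N := (NH F k).

Local Notation NHcls := (@cls F k).

Fact NHcls_ind (P : N -> Prop) : P 0 -> (forall w, P (NHcls w)) ->
  (forall c x y, P x -> P y -> P (c *: x + y)) -> forall x, P x.
Proof.
move=> P0 Pw PL x; rewrite (NH_words x).
apply: (big_rec P) => // w y _ Py.
exact: PL (Pw _) Py.
Qed.

Fact NHhomog_ind (P : N -> Prop) (d : int * int) : P 0 ->
  (forall w, word_deg w = d -> P (NHcls w)) ->
  (forall c x y, P x -> P y -> P (c *: x + y)) -> forall x, homog d x -> P x.
Proof.
move=> P0 Pw PL x [p pd <-].
rewrite [in P _](malg_words p) (big_morph _ (@pi_NHD F k) (pi_NH0 F k)) big_seq.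
apply: (big_rec P) => // w y wp Py; rewrite pi_NHZ.
exact: PL (Pw _ (pd w wp)) Py.
Qed.

Fact NHhomog0 d : homog d (0 : N).
Proof. by exists 0; [move=> w; rewrite msupp0 in_fset0 | exact: pi_NH0]. Qed.

Fact NHhomog_cls w : homog (word_deg w) (NHcls w).
Proof. by exists (mono F w) => // m; rewrite msuppU1 in_fset1 => /eqP ->. Qed.

Fact NHhomogL (d : int * int) c (x y : N) : homog d x -> homog d y -> homog d (c *: x + y).
Proof.
move=> [p pd <-] [q qd <-]; exists (c *: p + q); last by rewrite pi_NHD pi_NHZ.
move=> w /(fsubsetP (msuppD_le _ _)); rewrite in_fsetU => /orP[|/qd //].
by move/(fsubsetP (msuppZ_le _ _))/pd.
Qed.

Definition NH_str : nh_algebra F k := @NHAlgebra F k N NHcls (@homog F k)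
  (fun g => NH_ext (V := N) g) (@cls_nil F k) (@cls_cat F k)
  (@cls_word_rule F k) (@cls_sigsig F k) NHcls_ind NHhomog_ind NHhomog0
  NHhomog_cls NHhomogL
  (fun g gi => @NH_ext_is_linear F k N g gi.1 gi.2)
  (fun g gi => @NH_ext_cls F k N g gi.1 gi.2).

Lemma graded_MC_gMC (nu : cochain F k) : graded_MC nu <-> @gMC F k NH_str nu.
Proof.
split=> [[h1 h2 h3 h4 h5]|[h1 h2 h3 h4 h5]].
  split.
  - exact: h1.
  - by move=> b n; exact: h2.
  - exact: h3.
  - exact: h4.
  - exact: h5.
split.
- exact: h1.
- by move=> b n; exact: h2.
- exact: h3.
- exact: h4.
- exact: h5.
Qed.

Lemma arises_from_garises (a : F) (nu : cochain F k) :
  arises_from a nu <-> @garises F k NH_str a nu.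
Proof.
split=> [[/graded_MC_gMC MC h]|[/graded_MC_gMC MC h]]; split=> //.
Qed.

Lemma gauge_equiv_ggauge (nu nu' : cochain F k) :
  gauge_equiv nu nu' <-> @ggauge F k NH_str nu nu'.
Proof. by []. Qed.

End Instance.

(** Since [arises_from] is a condition on reductions and not a construction, that it determines
    exactly one deformation for each scalar is part of the claim. *)
Theorem lemma4p14 (R : realType) (k : nat) (hk : (1 <= k)%N) :
  [/\ forall a : R[i], exists! nu : cochain R[i] k, arises_from a nu,
      forall nu : cochain R[i] k, graded_MC nu ->
        exists (a : R[i]) (nu_a : cochain R[i] k),
          arises_from a nu_a /\ gauge_equiv nu nu_a
    & (1 < k)%N ->
      forall (a a' : R[i]) (nu_a nu_a' : cochain R[i] k), a <> a' ->
        arises_from a nu_a -> arises_from a' nu_a' ->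
        ~ gauge_equiv nu_a nu_a'].
Proof.
have two : 2%:R != 0 :> R[i] by rewrite pnatr_eq0.
have [h1 h2 h3] := nh_deformations (NH_str R[i] k) two.
split=> [a|nu /graded_MC_gMC/h2|k1 a a' nu nu' aa' /arises_from_garises H /arises_from_garises H'].
- have [nu [nua nu_uniq]] := h1 a; exists nu.
  by split=> [|nu' /arises_from_garises]; [exact/arises_from_garises | exact: nu_uniq].
- move=> [a [nu_a [H1 H2]]]; exists a, nu_a.
  by split; [exact/arises_from_garises | exact/gauge_equiv_ggauge].
- by move/gauge_equiv_ggauge; exact: h3 k1 a a' nu nu' aa' H H'.
Qed.
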